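(* Let $k$ be a field of characteristic $0$, and let $S\subset\mathbb{P}^4$ be the surface over $k$ defined by $$x_0^2+x_0x_3+x_2x_4=x_1x_3-x_2^2=0,$$ which is a singular quartic del Pezzo surface of type $\mathbf{A}_3+\mathbf{A}_1$. Let $\mathbb{G}_{\mathrm{a}}\rtimes\mathbb{G}_{\mathrm{m}}$ be the semidirect product of $\mathbb{G}_{\mathrm{a}}$ and $\mathbb{G}_{\mathrm{m}}$ via $\phi:\mathbb{G}_{\mathrm{m}}\to\mathrm{Aut}(\mathbb{G}_{\mathrm{a}})$ defined by $\phi_t(b)=t^{-1}b$ for $t\in\mathbb{G}_{\mathrm{m}}$, $b\in\mathbb{G}_{\mathrm{a}}$. Then $S$ is an equivariant compactification of $\mathbb{G}_{\mathrm{a}}\rtimes\mathbb{G}_{\mathrm{m}}$, but $S$ is neither toric nor an equivariant compactification of $\mathbb{G}_{\mathrm{a}}^2$.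
   Context: A singular del Pezzo surface is a singular projective normal surface with only $\mathbf{ADE}$-singularities whose anticanonical class is ample (over $k$: if this holds after base change to $\overline{k}$); it is quartic if its degree, the self-intersection number of its anticanonical class, is $4$. Type $\mathbf{A}_3+\mathbf{A}_1$ means that its singularities are one of type $\mathbf{A}_3$ and one of type $\mathbf{A}_1$. For a connected linear algebraic group $\mathbb{G}$ over $k$, a proper variety $V$ over $k$ is an equivariant compactification of $\mathbb{G}$ over $k$ if $\mathbb{G}$ acts on $V$, the action being defined over $k$, and there is an open subset $U\subset V$ which is equivariantly isomorphic to $\mathbb{G}$ over $k$ (with $\mathbb{G}$ acting on itself by translation). A del Pezzo surface is toric if it is an equivariant compactification of the two-dimensional torus $\mathbb{G}_{\mathrm{m}}^2$. The group law on $\mathbb{G}_{\mathrm{a}}\rtimes\mathbb{G}_{\mathrm{m}}$ is $(b,t)(b',t')=(b+t^{-1}b',tt')$. *)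

(* Defs.v *)
From HB Require Import structures.
From mathcomp Require Import all_boot all_order all_algebra.
From mathcomp Require Import ring boolp classical_sets.

Set Implicit Arguments.
Unset Strict Implicit.
Unset Printing Implicit Defensive.

Import GRing.Theory.
Local Open Scope classical_set_scope.
Local Open Scope ring_scope.

(* Schemes over k are represented by their functors of points on the category  *)
(* of commutative k-algebras.  This is faithful: by the Yoneda lemma,          *)
(* k-morphisms of schemes are exactly the natural transformations.  (The       *)
(* algebras of [comAlgType k] are nonzero; nothing is lost, since every scheme *)
(* has exactly one point with values in the zero ring.)                        *)
Record kfunctor (k : fieldType) : Type := KFunctor {
  pts :> comAlgType k -> Type;
  pmap : forall A B : comAlgType k, {lrmorphism A -> B} -> pts A -> pts B;
  pmap_id : forall (A : comAlgType k) (x : pts A),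
    pmap (idfun : {lrmorphism A -> A}) x = x;
  pmap_comp : forall (A B C : comAlgType k) (g : {lrmorphism B -> C})
    (f : {lrmorphism A -> B}) (x : pts A),
    pmap (g \o f : {lrmorphism A -> C}) x = pmap g (pmap f x) }.

(* Group schemes over k. *)
Record kgroup (k : fieldType) : Type := KGroup {
  gpts :> kfunctor k;
  gone : forall A : comAlgType k, gpts A;
  gmul : forall A : comAlgType k, gpts A -> gpts A -> gpts A;
  ginv : forall A : comAlgType k, gpts A -> gpts A;
  gmulA : forall A : comAlgType k, associative (@gmul A);
  gmul1 : forall A : comAlgType k, left_id (gone A) (@gmul A);
  gmulV : forall A : comAlgType k, left_inverse (gone A) (@ginv A) (@gmul A);
  pmap_mul : forall (A B : comAlgType k) (f : {lrmorphism A -> B}) (x y : gpts A),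
    pmap f (gmul x y) = gmul (pmap f x) (pmap f y) }.

(* ** Subfunctors *)

Definition subfunctor_stable (k : fieldType) (X : kfunctor k)
    (P : forall A : comAlgType k, set (X A)) : Prop :=
  forall (A B : comAlgType k) (f : {lrmorphism A -> B}) (x : X A),
    P A x -> P B (pmap f x).

Program Definition subfunctor (k : fieldType) (X : kfunctor k)
    (P : forall A : comAlgType k, set (X A)) (HP : subfunctor_stable P) :
    kfunctor k :=
  @KFunctor k (fun A => {x : X A | P A x})
    (fun A B f x => exist (P B) (pmap f (sval x)) (HP A B f _ (svalP x))) _ _.
Next Obligation. by apply: eq_exist; exact: pmap_id. Qed.
Next Obligation. by apply: eq_exist; exact: pmap_comp. Qed.

Definition generates_unit_ideal (R : comNzRingType) (X : set R) : Prop :=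
  exists (m : nat) (c x : 'I_m -> R),
    (forall i, X (x i)) /\ \sum_i c i * x i = 1.

(* For every A-point s of X (i.e. every Spec A -> X), the preimage of U is the *)
(* open subscheme of Spec A complementary to V(I) for some subset I of A.      *)
Definition open_subfunctor (k : fieldType) (X : kfunctor k)
    (U : forall A : comAlgType k, set (X A)) : Prop :=
  forall (A : comAlgType k) (s : X A), exists I : set A,
    forall (B : comAlgType k) (f : {lrmorphism A -> B}),
      U B (pmap f s) <-> generates_unit_ideal [set f a | a in I].

(* ** Projective space *)

Definition submodule (R : comNzRingType) (n : nat) (L : set 'rV[R]_n) : Prop :=
  L 0 /\ forall (a : R) (u v : 'rV[R]_n), L u -> L v -> L (a *: u + v).

Definition direct_summand (R : comNzRingType) (n : nat) (L : set 'rV[R]_n) :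
    Prop :=
  submodule L /\ exists M : set 'rV[R]_n,
    [/\ submodule M, forall u, L u -> M u -> u = 0
      & forall v, exists u w, [/\ L u, M w & v = u + w]].

(* L_f is free over R_f with basis w/1 (spelled out without localisation). *)
Definition free_rank1_at (R : comNzRingType) (n : nat) (L : set 'rV[R]_n)
    (f : R) (w : 'rV[R]_n) : Prop :=
  [/\ L w,
      forall v, L v -> exists (N : nat) (a : R), f ^+ N *: v = a *: w
    & forall a : R, a *: w = 0 -> exists N : nat, f ^+ N * a = 0].

Definition locally_free_rank1 (R : comNzRingType) (n : nat)
    (L : set 'rV[R]_n) : Prop :=
  exists (m : nat) (f : 'I_m -> R) (w : 'I_m -> 'rV[R]_n),
    generates_unit_ideal (range f) /\ forall i, free_rank1_at L (f i) (w i).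

(* The R-points of P^(n-1): direct summands of rank one of R^n. *)
Definition is_line (R : comNzRingType) (n : nat) (L : set 'rV[R]_n) : Prop :=
  direct_summand L /\ locally_free_rank1 L.

Definition rspan (R : comNzRingType) (n : nat) (X : set 'rV[R]_n) :
    set 'rV[R]_n :=
  [set v | exists (m : nat) (c : 'I_m -> R) (x : 'I_m -> 'rV[R]_n),
     (forall i, X (x i)) /\ v = \sum_i c i *: x i].

(* Since L is a direct summand of R^n, its base change along f : R -> R' is    *)
(* the submodule of R'^n generated by f(L).                                    *)
Definition base_change (R R' : comNzRingType) (f : {rmorphism R -> R'})
    (n : nat) (L : set 'rV[R]_n) : set 'rV[R']_n :=
  rspan [set map_mx f v | v in L].

Lemma submodule_sum (R : comNzRingType) n (L : set 'rV[R]_n) (I : Type)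
    (r : seq I) (c : I -> R) (x : I -> 'rV[R]_n) :
  submodule L -> (forall i, L (x i)) -> L (\sum_(i <- r) c i *: x i).
Proof.
move=> [L0 LD] Lx; elim: r => [|i r IH]; first by rewrite big_nil.
by rewrite big_cons; apply: LD.
Qed.

Lemma rspan_gen (R : comNzRingType) n (X : set 'rV[R]_n) v : X v -> rspan X v.
Proof.
move=> Xv; exists 1%N, (fun=> 1), (fun=> v); split=> //.
by rewrite big_ord1 scale1r.
Qed.

Lemma rspan_submodule (R : comNzRingType) n (X : set 'rV[R]_n) :
  submodule (rspan X).
Proof.
split; first by exists 0%N, (fun=> 0), (fun=> 0); split=> [[]//|]; rewrite big_ord0.
move=> a u v [m [c [x [Xx ->]]]] [p [d [y [Xy ->]]]].
exists (m + p)%N, (fun i => match split i with inl j => a * c j | inr j => d j end),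
  (fun i => match split i with inl j => x j | inr j => y j end); split.
  by move=> i; case: (split i).
rewrite big_split_ord /= scaler_sumr; congr (_ + _); apply: eq_bigr => i _.
  by rewrite -/(unsplit (inl i)) unsplitK scalerA.
by rewrite -/(unsplit (inr i)) unsplitK.
Qed.

Lemma rspan_min (R : comNzRingType) n (X L : set 'rV[R]_n) :
  submodule L -> X `<=` L -> rspan X `<=` L.
Proof.
by move=> sL XL v [m [c [x [Xx ->]]]]; apply: submodule_sum => // i; apply: XL.
Qed.

Lemma direct_summandP (R : comNzRingType) n (L : set 'rV[R]_n) :
  direct_summand L <-> submodule L /\ exists E : 'M[R]_n,
    (forall v, L (v *m E)) /\ (forall v, L v -> v *m E = v).
Proof.
split=> [[sL [M [sM LM0 LM]]]|[sL [E [EL LE]]]]; last first.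
  split=> //; exists [set v | v *m E = 0]; split.
  - split=> /= [|a u v Hu Hv]; first by rewrite mul0mx.
    by rewrite mulmxDl -scalemxAl Hu Hv scaler0 addr0.
  - by move=> u Lu; rewrite /= LE.
  - move=> v; exists (v *m E), (v - v *m E); split => //=.
      by rewrite mulmxBl (LE _ (EL v)) subrr.
    by rewrite addrC subrK.
split=> //.
have subL (N : set 'rV[R]_n) (u v : 'rV[R]_n) :
    submodule N -> N u -> N v -> N (u - v).
  by move=> [_ ND] Nu Nv; rewrite addrC -scaleN1r; apply: ND.
have /choice[p pP] : forall v, exists u, L u /\ M (v - u).
  by move=> v; have [u [w [Lu Mw ->]]] := LM v; exists u; rewrite addrC addKr.
pose E := \matrix_i p (delta_mx 0 i).
have EL v : L (v *m E).
  rewrite mulmx_sum_row; apply: submodule_sum => // i.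
  by rewrite rowK; have [] := pP (delta_mx 0 i).
exists E; split=> // v Lv; apply/eqP; rewrite -subr_eq0; apply/eqP.
apply: LM0; first exact: subL.
suff Mv : M (v - v *m E) by rewrite -opprB -scaleN1r -[_ *: _]addr0; apply: sM.2 (sM.1).
rewrite {1}(row_sum_delta v) mulmx_sum_row -sumrB.
under eq_bigr do rewrite -scalerBr rowK.
by apply: submodule_sum => // i; have [] := pP (delta_mx 0 i).
Qed.

Lemma generates_unit_ideal_map (R R' : comNzRingType)
    (phi : {rmorphism R -> R'}) (X : set R) (X' : set R') :
  (forall x, X x -> X' (phi x)) ->
  generates_unit_ideal X -> generates_unit_ideal X'.
Proof.
move=> XX' [m [c [x [Xx cx]]]]; exists m, (phi \o c), (phi \o x); split.
  by move=> i; apply: XX'.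
by rewrite -(rmorph1 phi) -cx rmorph_sum; apply: eq_bigr => i _; rewrite rmorphM.
Qed.

Lemma is_line_base_change (R R' : comNzRingType) (phi : {rmorphism R -> R'})
    n (L : set 'rV[R]_n) :
  is_line L -> is_line (base_change phi L).
Proof.
move=> [/direct_summandP[sL [E [EL LE]]] [m [f [w [genf fw]]]]].
have sL' : submodule (base_change phi L) by exact: rspan_submodule.
split.
  apply/direct_summandP; split => //; exists (map_mx phi E); split=> v.
    rewrite mulmx_sum_row; apply: submodule_sum => // i; apply: rspan_gen.
    by exists (row i E); [rewrite rowE|rewrite map_row].
  move=> [p [c [x [Lx ->]]]]; rewrite mulmx_suml; apply: eq_bigr => i _.
  by have [y Ly <-] := Lx i; rewrite -scalemxAl -map_mxM LE.
exists m, (phi \o f), (fun i => map_mx phi (w i)); split.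
  apply: generates_unit_ideal_map genf => _ [i _ <-]; by exists i.
move=> i; have [Lw wL wfree] := fw i; split.
- by apply: rspan_gen; exists (w i).
- apply: rspan_min; last first.
    move=> _ [v Lv <-]; have [N [a Na]] := wL v Lv; exists N, (phi a).
    by rewrite /= -rmorphXn -!map_mxZ Na.
  split; first by exists 0%N, 0; rewrite scaler0 scale0r.
  move=> a u v [N [b Hb]] [M [c Hc]].
  exists (N + M)%N, (a * b * (phi (f i)) ^+ M + c * (phi (f i)) ^+ N).
  rewrite /= scalerDr scalerDl scalerA exprD; congr (_ + _).
    transitivity ((a * phi (f i) ^+ M) *: (phi (f i) ^+ N *: u)).
      by rewrite scalerA; congr (_ *: _); ring.
    by rewrite Hb scalerA; congr (_ *: _); ring.
  transitivity (phi (f i) ^+ N *: (phi (f i) ^+ M *: v)); first by rewrite scalerA.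
  by rewrite Hc scalerA mulrC.
- move=> a aw0.
  have /choice[Na NaP] : forall j, exists Na : nat * R,
      f i ^+ Na.1 *: row j E = Na.2 *: w i.
    move=> j; have [|N [b Hb]] := wL (row j E); first by rewrite rowE.
    by exists (N, b).
  pose N := (\sum_j (Na j).1)%N.
  pose A := \col_j (f i ^+ (N - (Na j).1) * (Na j).2).
  have AE : f i ^+ N *: E = A *m w i.
    apply/row_matrixP => j; rewrite row_mul linearZ /=.
    have NaN : ((Na j).1 <= N)%N by rewrite /N (bigD1 j) //= leq_addr.
    rewrite -{1}(subnK NaN) exprD -scalerA NaP scalerA.
    apply/rowP => l; rewrite !mxE big_ord1 !mxE.
    by congr (_ * _).
  have sw : (f i ^+ N - (w i *m A) 0 0) *: w i = 0.
    rewrite scalerBl -{1}(LE _ Lw) scalemxAr AE mulmxA.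
    by rewrite {1}[w i *m A]mx11_scalar mul_scalar_mx subrr.
  have [M HM] := wfree _ sw; exists (M + N)%N.
  have as0 : a * phi ((w i *m A) 0 0) = 0.
    have <- : (a *: map_mx phi (w i) *m map_mx phi A) 0 0
       = a * phi ((w i *m A) 0 0).
      by rewrite -scalemxAl -map_mxM !mxE.
    by rewrite aw0 mul0mx mxE.
  move: HM => /(congr1 phi); rewrite rmorphM rmorphB !rmorphXn rmorph0 /=.
  rewrite mulrBr -exprD => /eqP; rewrite subr_eq0 => /eqP ->.
  by rewrite -mulrA [_ * a]mulrC as0 mulr0.
Qed.

Lemma base_change_id (R : comNzRingType) n (L : set 'rV[R]_n) :
  submodule L -> base_change (idfun : {rmorphism R -> R}) L = L.
Proof.
move=> sL; apply/seteqP; split.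
  by apply: rspan_min => // _ [v Lv <-]; rewrite map_mx_id.
by move=> v Lv; apply: rspan_gen; exists v => //; rewrite map_mx_id.
Qed.

Lemma base_change_comp (R S T : comNzRingType) (g : {rmorphism S -> T})
    (f : {rmorphism R -> S}) n (L : set 'rV[R]_n) :
  base_change (g \o f : {rmorphism R -> T}) L =
  base_change g (base_change f L).
Proof.
apply/seteqP; split; apply: rspan_min; try exact: rspan_submodule.
  move=> _ [v Lv <-]; apply: rspan_gen; exists (map_mx f v).
    by apply: rspan_gen; exists v.
  by apply/matrixP => i j; rewrite !mxE.
move=> _ [v [m [c [x [Lx ->]]]] <-]; rewrite map_mx_sum.
under eq_bigr do rewrite map_mxZ.
apply: submodule_sum; first exact: rspan_submodule.
move=> i; apply: rspan_gen; have [y Ly <-] := Lx i; exists y => //.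
by apply/matrixP => a b; rewrite !mxE.
Qed.

Program Definition projective_space (k : fieldType) (n : nat) : kfunctor k :=
  @KFunctor k (fun A => {L : set 'rV[A]_n.+1 | is_line L})
    (fun A B f L =>
       exist (@is_line B n.+1) (base_change f (sval L)) (is_line_base_change f (svalP L)))
    _ _.
Next Obligation.
by apply: eq_exist; apply: base_change_id; case: H => -[].
Qed.
Next Obligation. by apply: eq_exist; exact: base_change_comp. Qed.

(* ** The surface S *)

Definition quadrics_vanish (R : comNzRingType) (v : 'rV[R]_5) : Prop :=
  let x (i : nat) := v 0 (inord i) in
  x 0%N ^+ 2 + x 0%N * x 3%N + x 2%N * x 4%N = 0 /\
  x 1%N * x 3%N - x 2%N ^+ 2 = 0.

(* A line L is a point of the closed subscheme cut out by homogeneous forms if *)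
(* and only if the forms vanish at the local generators of L, equivalently at  *)
(* all elements of L.                                                          *)
Definition S_equations (k : fieldType) (A : comAlgType k) :
    set (projective_space k 4 A) :=
  [set L | forall v : 'rV[A]_5, sval L v -> quadrics_vanish v].

Lemma S_equations_stable (k : fieldType) : subfunctor_stable (@S_equations k).
Proof.
move=> A B f [L HL] /= SL v /= [m [c [x [Lx ->]]]].
have sL : submodule L by have [[]] := HL.
pose q1 (u : 'rV[B]_5) := let x i := u 0 (inord i) in
  x 0%N ^+ 2 + x 0%N * x 3%N + x 2%N * x 4%N.
pose q2 (u : 'rV[B]_5) := let x i := u 0 (inord i) in
  x 1%N * x 3%N - x 2%N ^+ 2.
pose b1 (u v : 'rV[B]_5) := let x i := u 0 (inord i) in let y i := v 0 (inord i) in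
  x 0%N * y 0%N *+ 2 + (x 0%N * y 3%N + y 0%N * x 3%N)
  + (x 2%N * y 4%N + y 2%N * x 4%N).
pose b2 (u v : 'rV[B]_5) := let x i := u 0 (inord i) in let y i := v 0 (inord i) in
  (x 1%N * y 3%N + y 1%N * x 3%N) - x 2%N * y 2%N *+ 2.
have q1D a u w : q1 (a *: u + w) = a ^+ 2 * q1 u + a * b1 u w + q1 w.
  by rewrite /q1 /b1 /= !mxE; ring.
have q2D a u w : q2 (a *: u + w) = a ^+ 2 * q2 u + a * b2 u w + q2 w.
  by rewrite /q2 /b2 /= !mxE; ring.
have b1D a u w z : b1 z (a *: u + w) = a * b1 z u + b1 z w.
  by rewrite /b1 /= !mxE; ring.
have b2D a u w z : b2 z (a *: u + w) = a * b2 z u + b2 z w.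
  by rewrite /b2 /= !mxE; ring.
have qL u : L u -> q1 (map_mx f u) = 0 /\ q2 (map_mx f u) = 0.
  move=> /SL[/= e1 e2]; rewrite /q1 /q2 /=; split; rewrite !mxE.
    by rewrite -!rmorphM -rmorphXn -!rmorphD e1 rmorph0.
  by rewrite -!rmorphM -rmorphXn -!rmorphB e2 rmorph0.
have bL u w : L u -> L w ->
    b1 (map_mx f u) (map_mx f w) = 0 /\ b2 (map_mx f u) (map_mx f w) = 0.
  move=> Lu Lw; have [] := qL _ (sL.2 1 _ _ Lu Lw).
  have [u1 u2] := qL _ Lu; have [w1 w2] := qL _ Lw.
  by rewrite map_mxD map_mxZ rmorph1 q1D q2D u1 u2 w1 w2 !mulr0 !add0r !addr0 !mul1r.
suff [[]] : (q1 (\sum_i c i *: x i) = 0 /\ q2 (\sum_i c i *: x i) = 0) /\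
    forall w, L w -> b1 (map_mx f w) (\sum_i c i *: x i) = 0 /\
                     b2 (map_mx f w) (\sum_i c i *: x i) = 0 by [].
elim/big_rec: _ => [|i y _ [[y1 y2] yb]].
  split=> [|w _]; first by rewrite /q1 /q2 /= !mxE; split; ring.
  by rewrite /b1 /b2 /= !mxE; split; ring.
have [z Lz <-] := Lx i; have [z1 z2] := qL _ Lz; have [zy1 zy2] := yb _ Lz.
split; first by rewrite q1D q2D z1 z2 zy1 zy2 y1 y2 !mulr0 !addr0.
move=> w Lw; have [yw1 yw2] := yb _ Lw; have [zw1 zw2] := bL _ _ Lw Lz.
by rewrite b1D b2D yw1 yw2 zw1 zw2 !mulr0 !addr0.
Qed.

Definition surfaceS (k : fieldType) : kfunctor k :=
  subfunctor (@S_equations_stable k).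

(* ** The groups *)

Program Definition Ga_functor (k : fieldType) : kfunctor k :=
  @KFunctor k (fun A => A) (fun A B f x => f x) _ _.

Program Definition Ga (k : fieldType) : kgroup k :=
  @KGroup k (Ga_functor k) (fun A => 0 : A) (fun A x y => (x : A) + (y : A))
    (fun A x => - (x : A)) _ _ _ _.
Next Obligation. exact: addrA. Qed.
Next Obligation. by move=> x; exact: add0r. Qed.
Next Obligation. by move=> x; exact: addNr. Qed.
Next Obligation. exact: rmorphD. Qed.

(* A unit t is represented by the pair (t, t^-1). *)
Definition Gm_pts (R : comNzRingType) : Type := {p : R * R | p.1 * p.2 == 1}.

Program Definition Gm_functor (k : fieldType) : kfunctor k :=
  @KFunctor k (fun A => Gm_pts A)
    (fun A B f t => exist _ (f (sval t).1, f (sval t).2) _) _ _.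
Next Obligation. by case: t => -[t u] /= /eqP tu; rewrite -rmorphM tu rmorph1. Qed.
Next Obligation. by case: x => -[t u] ?; apply: eq_exist. Qed.
Next Obligation. by apply: eq_exist. Qed.

Program Definition Gm (k : fieldType) : kgroup k :=
  @KGroup k (Gm_functor k)
    (fun A => exist _ (1, 1) _)
    (fun A s t => exist _ ((sval s).1 * (sval t).1, (sval s).2 * (sval t).2) _)
    (fun A t => exist _ ((sval t).2, (sval t).1) _) _ _ _ _.
Next Obligation. by rewrite mulr1. Qed.
Next Obligation.
case: s t => -[s s'] /= /eqP ss' [[t t'] /= /eqP tt'].
by rewrite mulrACA ss' tt' mulr1.
Qed.
Next Obligation. by case: t => -[t u] /= /eqP tu; rewrite mulrC tu. Qed.
Next Obligation. by move=> x y z; apply: eq_exist; rewrite /= !mulrA. Qed.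
Next Obligation. by move=> [[x y] p]; apply: eq_exist; rewrite /= !mul1r. Qed.
Next Obligation.
by move=> [[x y] p]; apply: eq_exist; move/eqP: (p) => /= q; rewrite mulrC q.
Qed.
Next Obligation. by apply: eq_exist; rewrite /= !rmorphM. Qed.

Definition product_functor (k : fieldType) (X Y : kfunctor k) : kfunctor k.
Proof.
refine (@KFunctor k (fun A => (X A * Y A)%type)
  (fun A B f p => (pmap f p.1, pmap f p.2)) _ _).
- by move=> A [x y] /=; rewrite !pmap_id.
- by move=> A B C g f [x y] /=; rewrite !pmap_comp.
Defined.

(* An action phi : H -> Aut(N) of H on N by group automorphisms. *)
Record aut_action (k : fieldType) (H N : kgroup k) : Type := AutAction {
  aut_act :> forall A : comAlgType k, H A -> N A -> N A;
  aut_act1 : forall (A : comAlgType k) (n : N A), aut_act (gone H A) n = n;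
  aut_actM : forall (A : comAlgType k) (h h' : H A) (n : N A),
    aut_act (gmul h h') n = aut_act h (aut_act h' n);
  aut_act_mul : forall (A : comAlgType k) (h : H A) (n n' : N A),
    aut_act h (gmul n n') = gmul (aut_act h n) (aut_act h n');
  aut_act_map : forall (A B : comAlgType k) (f : {lrmorphism A -> B})
    (h : H A) (n : N A), pmap f (aut_act h n) = aut_act (pmap f h) (pmap f n) }.

Lemma gmul_idem (k : fieldType) (G : kgroup k) (A : comAlgType k) (x : G A) :
  gmul x x = x -> x = gone G A.
Proof.
by move=> xx; rewrite -(gmulV x) -{3}xx gmulA gmulV gmul1.
Qed.

Definition semidirect_product (k : fieldType) (N H : kgroup k)
    (phi : aut_action H N) : kgroup k.
Proof.
refine (@KGroup k (product_functor N H)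
  (fun A => (gone N A, gone H A))
  (fun A x y => (gmul x.1 (phi A x.2 y.1), gmul x.2 y.2))
  (fun A x => (phi A (ginv x.2) (ginv x.1), ginv x.2)) _ _ _ _).
- move=> A [a s] [b t] [c u] /=.
  by rewrite aut_act_mul aut_actM !gmulA.
- by move=> A [a s] /=; rewrite aut_act1 !gmul1.
- move=> A [a s] /=; rewrite -aut_act_mul !gmulV; congr pair.
  by apply: gmul_idem; rewrite -aut_act_mul gmul1.
- by move=> A B f [a s] [b t] /=; rewrite !pmap_mul aut_act_map.
Defined.

Definition trivial_action (k : fieldType) (H N : kgroup k) : aut_action H N.
Proof. by refine (@AutAction k H N (fun A _ n => n) _ _ _ _). Defined.

Definition direct_product (k : fieldType) (N H : kgroup k) : kgroup k :=
  semidirect_product (trivial_action H N).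

Program Definition GmGa_action (k : fieldType) : aut_action (Gm k) (Ga k) :=
  @AutAction k (Gm k) (Ga k) (fun A t b => (sval t).2 * (b : A)) _ _ _ _.
Next Obligation. exact: mul1r. Qed.
Next Obligation. exact/esym/mulrA. Qed.
Next Obligation. exact: mulrDr. Qed.
Next Obligation. exact: rmorphM. Qed.

Definition Ga_rtimes_Gm (k : fieldType) : kgroup k :=
  semidirect_product (GmGa_action k).

(* ** Equivariant compactifications *)

Definition is_action (k : fieldType) (G : kgroup k) (V : kfunctor k)
    (act : forall A : comAlgType k, G A -> V A -> V A) : Prop :=
  [/\ forall (A : comAlgType k) (x : V A), act A (gone G A) x = x,
      forall (A : comAlgType k) (g h : G A) (x : V A),
        act A (gmul g h) x = act A g (act A h x)
    & forall (A B : comAlgType k) (f : {lrmorphism A -> B}) (g : G A) (x : V A),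
        pmap f (act A g x) = act B (pmap f g) (pmap f x)].

(* For V a proper variety and G a connected linear algebraic group. *)
Definition equivariant_compactification (k : fieldType) (G : kgroup k)
    (V : kfunctor k) : Prop :=
  exists (act : forall A : comAlgType k, G A -> V A -> V A)
         (U : forall A : comAlgType k, set (V A))
         (j : forall A : comAlgType k, G A -> V A),
    [/\ is_action act,
        open_subfunctor U,
        forall (A B : comAlgType k) (f : {lrmorphism A -> B}) (g : G A),
          pmap f (j A g) = j B (pmap f g),
        forall A : comAlgType k, injective (j A) /\ range (j A) = U A
      & forall (A : comAlgType k) (g h : G A), j A (gmul g h) = act A g (j A h)].

Definition toric (k : fieldType) (V : kfunctor k) : Prop :=
  equivariant_compactification (direct_product (Gm k) (Gm k)) V.

(* Main.v *)
From HB Require Import structures.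
From mathcomp Require Import all_boot all_algebra.
From mathcomp Require Import ring zify boolp classical_sets.
Require Import Defs.

Set Implicit Arguments.
Unset Strict Implicit.
Unset Printing Implicit Defensive.

Import GRing.Theory.
Local Open Scope classical_set_scope.
Local Open Scope ring_scope.

(** The open orbit of G_a x| G_m is {x2 <> 0}, the complement of the three
    lines of S; there S has coordinates x = x0/x2 and t = x3/x2, and
    (b, s) acts by (x, t) |-> (s^-1 x + b, s^-1 t), which extends to linear maps
    of P^4.

    An action of a commutative group is excluded by computing the global vector
    fields of S, seen as tangent vectors over dual numbers.  Such a field is
    determined by its values on {x2 <> 0}; requiring that it stay regular along
    enough curves that leave this open set through the lines of S and through
    the A1-singularity shows that it is (a + b x) d/dx + b t d/dt with constants
    a and b.  Two commuting fields of this shape are proportional, so a nonzero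
    combination of two independent commuting tangent directions of the group
    acts trivially on {x2 <> 0}, hence fixes every point of S to first order,
    which contradicts the freeness of the action on the open orbit. *)

(** * Lines spanned by a vector *)

Definition line_of (R : comNzRingType) n (v : 'rV[R]_n) : set 'rV[R]_n :=
  [set a *: v | a in setT].

Lemma line_of_gen (R : comNzRingType) n (v : 'rV[R]_n) : line_of v v.
Proof. by exists 1; rewrite ?scale1r. Qed.

Lemma line_of_submodule (R : comNzRingType) n (v : 'rV[R]_n) :
  submodule (line_of v).
Proof.
split; first by exists 0; rewrite ?scale0r.
by move=> a _ _ [b _ <-] [c _ <-]; exists (a * b + c); rewrite // scalerDl scalerA.
Qed.

Lemma line_of_base_change (R R' : comNzRingType) (f : {rmorphism R -> R'}) n
    (v : 'rV[R]_n) :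
  base_change f (line_of v) = line_of (map_mx f v).
Proof.
apply/seteqP; split.
  apply: rspan_min => [|_ [_ [a _ <-] <-]]; first exact: line_of_submodule.
  by exists (f a); rewrite // map_mxZ.
move=> _ [a _ <-]; rewrite -[_ *: _]addr0.
have [bc0 bcD] := rspan_submodule [set map_mx f u | u in line_of v].
by apply: bcD => //; apply: rspan_gen; exists v => //; exact: line_of_gen.
Qed.

(** A coordinate equal to 1 splits the span off: the vectors whose coordinate [i] vanishes form a
    complement. *)
Lemma line_of_is_line (R : comNzRingType) n (v : 'rV[R]_n) (i : 'I_n) :
  v 0 i = 1 -> is_line (line_of v).
Proof.
move=> vi1; split; last first.
  exists 1%N, (fun=> 1), (fun=> v); split.
    exists 1%N, (fun=> 1), (fun=> 1); split; last by rewrite big_ord1 mulr1.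
    by move=> _; exists ord0.
  move=> _; split; first exact: line_of_gen.
    by move=> _ [a _ <-]; exists 0%N, a; rewrite expr0 scale1r.
  move=> a /rowP/(_ i); rewrite !mxE vi1 mulr1 => ->; exists 0%N.
  by rewrite mulr0.
split; first exact: line_of_submodule.
exists [set w : 'rV[R]_n | w 0 i = 0]; split.
- split=> [|a u w /= u0 w0]; first by rewrite /= mxE.
  by rewrite !mxE u0 w0 mulr0 addr0.
- by move=> _ [a _ <-] /=; rewrite mxE vi1 mulr1 => ->; rewrite scale0r.
- move=> w; exists (w 0 i *: v), (w - w 0 i *: v); split.
  + by exists (w 0 i).
  + by rewrite /= !mxE vi1 mulr1 subrr.
  + by rewrite addrC subrK.
Qed.

(** The ring elements with a power killing [v] are stable under multiples and, by the binomial
    formula, under sums; here they contain 1. *)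
Lemma generates_unit_ideal_pow0 (R : comNzRingType) n (m : nat) (f : 'I_m -> R)
    (N : 'I_m -> nat) (v : 'rV[R]_n) :
  generates_unit_ideal (range f) -> (forall i, f i ^+ N i *: v = 0) -> v = 0.
Proof.
move=> [p [c [x [fx cx]]]] fv.
have /choice[M HM] : forall j, exists M, x j ^+ M *: v = 0.
  by move=> j; have [i _ <-] := fx j; exists (N i).
suff H : forall r : seq 'I_p, exists K, (\sum_(j <- r) c j * x j) ^+ K *: v = 0.
  by have [K] := H (index_enum _); rewrite cx expr1n scale1r.
elim=> [|j r [K HK]]; first by exists 1%N; rewrite big_nil expr1 scale0r.
have scale0 a b c' (u : 'rV[R]_n) : a *: u = 0 -> (b * (a * c')) *: u = 0.
  by move=> au; rewrite mulrCA mulrC -scalerA au scaler0.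
(* In each binomial term either the factor from [j] has exponent at least [M j], or the rest has
   exponent at least [K]. *)
exists (M j + K)%N; rewrite big_cons exprDn scaler_suml big1 // => i _.
rewrite -scalerMnl; have [Ki|Ki] := leqP K i.
  by rewrite -(subnKC Ki) exprD scale0 ?mul0rn.
have Mi : (M j <= M j + K - i)%N by rewrite -addnBA ?leq_addr // ltnW.
by rewrite exprMn mulrAC -{2}(subnKC Mi) exprD scale0 ?mul0rn.
Qed.

(** Where [f j] is inverted, [u] and [v] are both multiples of [w j], so their 2 by 2 minors vanish;
    as [v 0 i = 1], a power of [f j] kills [u 0 i *: v - u]. *)
Lemma is_line_eq (R : comNzRingType) n (L : set 'rV[R]_n) (v : 'rV[R]_n) i :
  is_line L -> L v -> v 0 i = 1 -> L = line_of v.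
Proof.
move=> [[[L0 LD] _] [m [f [w [genf fw]]]]] Lv vi1; apply/seteqP; split.
  move=> u Lu; exists (u 0 i) => //; apply/eqP; rewrite -subr_eq0; apply/eqP.
  have /choice[N HN] : forall j, exists N, f j ^+ N *: (u 0 i *: v - u) = 0.
    move=> j; have [Lw wL _] := fw j.
    have [N [a Na]] := wL _ Lu; have [M [b Mb]] := wL _ Lv.
    exists (M + N)%N; have /rowP/(_ i) := Mb; rewrite !mxE vi1 mulr1 => Mw.
    have /rowP/(_ i) := Na; rewrite !mxE => Nw.
    apply/rowP => l; have /rowP/(_ l) := Mb; have /rowP/(_ l) := Na.
    rewrite !mxE => Nl Ml.
    have -> : f j ^+ (M + N) * (u 0 i * v 0 l - u 0 l) =
        (f j ^+ N * u 0 i) * (f j ^+ M * v 0 l) - f j ^+ M * (f j ^+ N * u 0 l).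
      by rewrite exprD; ring.
    by rewrite Nw Ml Nl Mw; ring.
  exact: generates_unit_ideal_pow0 genf HN.
by move=> _ [a _ <-]; rewrite -[_ *: _]addr0; apply: LD.
Qed.

(** * Homogeneous coordinates on S *)

Definition vec5 (R : comNzRingType) (x0 x1 x2 x3 x4 : R) : 'rV[R]_5 :=
  \row_i [:: x0; x1; x2; x3; x4]`_i.

Lemma vec5E (R : comNzRingType) (x0 x1 x2 x3 x4 : R) :
  let v := vec5 x0 x1 x2 x3 x4 in
  ((v 0 (inord 0) = x0) * (v 0 (inord 1) = x1) * (v 0 (inord 2) = x2) *
   (v 0 (inord 3) = x3) * (v 0 (inord 4) = x4))%type.
Proof. by rewrite /=; do !split; rewrite mxE inordK. Qed.

Lemma rV5P (R : comNzRingType) (u v : 'rV[R]_5) :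
  (forall i : nat, (i < 5)%N -> u 0 (inord i) = v 0 (inord i)) -> u = v.
Proof. by move=> uv; apply/rowP => i; rewrite -(inord_val i); apply: uv. Qed.

Lemma vec5_eta (R : comNzRingType) (v : 'rV[R]_5) :
  v = vec5 (v 0 (inord 0)) (v 0 (inord 1)) (v 0 (inord 2)) (v 0 (inord 3))
           (v 0 (inord 4)).
Proof. by apply: rV5P; do 5?case=> [|] //; rewrite vec5E. Qed.

Lemma map_vec5 (R R' : comNzRingType) (f : {rmorphism R -> R'})
    (x0 x1 x2 x3 x4 : R) :
  map_mx f (vec5 x0 x1 x2 x3 x4) = vec5 (f x0) (f x1) (f x2) (f x3) (f x4).
Proof. by apply: rV5P; do 5?case=> [|] //; rewrite vec5E mxE vec5E. Qed.

Lemma scale_vec5 (R : comNzRingType) (a x0 x1 x2 x3 x4 : R) :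
  a *: vec5 x0 x1 x2 x3 x4 =
  vec5 (a * x0) (a * x1) (a * x2) (a * x3) (a * x4).
Proof. by apply: rV5P; do 5?case=> [|] //; rewrite vec5E mxE vec5E. Qed.

Lemma quadrics_vec5 (R : comNzRingType) (x0 x1 x2 x3 x4 : R) :
  quadrics_vanish (vec5 x0 x1 x2 x3 x4) <->
  x0 ^+ 2 + x0 * x3 + x2 * x4 = 0 /\ x1 * x3 = x2 ^+ 2.
Proof.
rewrite /quadrics_vanish !vec5E; split=> -[-> e]; split=> //.
  by apply/eqP; rewrite -subr_eq0 e.
by rewrite e subrr.
Qed.

Lemma quadrics_scale (R : comNzRingType) (a : R) (v : 'rV[R]_5) :
  quadrics_vanish v -> quadrics_vanish (a *: v).
Proof.
rewrite (vec5_eta v) scale_vec5 !quadrics_vec5 => -[e1 e2]; split; last first.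
  by rewrite mulrACA e2 -!expr2 exprMn.
by rewrite -(mulr0 (a ^+ 2)) -e1; ring.
Qed.

(** [v] is a global vector of homogeneous coordinates of [s]; points whose line is not free have
    none. *)
Definition spans (k : fieldType) (A : comAlgType k) (s : surfaceS k A)
  (v : 'rV[A]_5) : Prop := sval (sval s) = line_of v.

Lemma surfaceS_eq (k : fieldType) (A : comAlgType k) (s s' : surfaceS k A) :
  sval (sval s) = sval (sval s') -> s = s'.
Proof.
by case: s s' => [[L HL] SL] [[L' HL'] SL'] /= e; do 2!apply: eq_exist.
Qed.

Lemma spans_eq (k : fieldType) (A : comAlgType k) (s s' : surfaceS k A) v :
  spans s v -> spans s' v -> s = s'.
Proof. by rewrite /spans => sv s'v; apply: surfaceS_eq; rewrite sv. Qed.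

Lemma spans_map (k : fieldType) (A B : comAlgType k) (f : {lrmorphism A -> B})
    (s : surfaceS k A) v :
  spans s v -> spans (pmap f s) (map_mx f v).
Proof. by rewrite /spans /= => ->; rewrite line_of_base_change. Qed.

Lemma spans_scale (k : fieldType) (A : comAlgType k) (s : surfaceS k A) u v i :
  spans s u -> spans s v -> v 0 i = 1 -> u = u 0 i *: v.
Proof.
move=> + + vi1; rewrite /spans => -> Lu.
have : line_of v u by rewrite -Lu; exact: line_of_gen.
by move=> [a _ <-]; rewrite mxE vi1 mulr1.
Qed.

Lemma spans_quadrics (k : fieldType) (A : comAlgType k) (s : surfaceS k A) v :
  spans s v -> quadrics_vanish v.
Proof. by move=> sv; apply: (svalP s); rewrite sv; exact: line_of_gen. Qed.

Lemma spans_mem (k : fieldType) (A : comAlgType k) (s : surfaceS k A) v i :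
  sval (sval s) v -> v 0 i = 1 -> spans s v.
Proof. by move=> sv vi1; apply: is_line_eq sv vi1; apply: svalP. Qed.

Lemma point_subproof (k : fieldType) (A : comAlgType k) (v : 'rV[A]_5)
    (q : quadrics_vanish v) i (vi1 : v 0 i = 1) :
  S_equations (exist _ (line_of v) (line_of_is_line vi1) : projective_space k 4 A).
Proof. by move=> _ [a _ <-]; exact: quadrics_scale. Qed.

Definition point (k : fieldType) (A : comAlgType k) (v : 'rV[A]_5)
    (q : quadrics_vanish v) i (vi1 : v 0 i = 1) : surfaceS k A :=
  exist _ _ (@point_subproof _ _ _ q _ vi1).

Lemma point_spans (k : fieldType) (A : comAlgType k) (v : 'rV[A]_5)
    (q : quadrics_vanish v) i (vi1 : v 0 i = 1) : spans (point q vi1) v.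
Proof. by []. Qed.

(** * The action of the semidirect product *)

Section MovedLines.
Variables (R : comNzRingType) (n : nat) (T T' : 'rV[R]_n -> 'rV[R]_n).
Hypotheses (linT : forall a u v, T (a *: u + v) = a *: T u + T v)
  (linT' : forall a u v, T' (a *: u + v) = a *: T' u + T' v)
  (TK : cancel T T') (T'K : cancel T' T).

Let T0 : T 0 = 0.
Proof. by have := linT (-1) 0 0; rewrite scaler0 addr0 scaleN1r addNr. Qed.

Let T'0 : T' 0 = 0.
Proof. by have := linT' (-1) 0 0; rewrite scaler0 addr0 scaleN1r addNr. Qed.

Let TZ a v : T (a *: v) = a *: T v.
Proof. by rewrite -[a *: v]addr0 linT T0 addr0. Qed.

Let T'Z a v : T' (a *: v) = a *: T' v.
Proof. by rewrite -[a *: v]addr0 linT' T'0 addr0. Qed.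

Lemma submodule_preimage L : submodule L -> submodule (T' @^-1` L).
Proof.
by move=> [L0 LD]; split=> [|a u v Lu Lv]; rewrite /= ?T'0 ?linT' //; apply: LD.
Qed.

(** The image of a line under [T] is written as a preimage under [T'], which makes membership
    immediate; complement and local generators are transported along. *)
Lemma is_line_preimage L : is_line L -> is_line (T' @^-1` L).
Proof.
move=> [[sL [M [sM LM0 LM]]] [m [f [w [genf fw]]]]]; split.
  split; first exact: submodule_preimage.
  exists (T' @^-1` M); split; first exact: submodule_preimage.
    by move=> u /= Lu Mu; apply: (can_inj T'K); rewrite T'0; apply: LM0.
  move=> v; have [u [x [Lu Mx e]]] := LM (T' v).
  exists (T u), (T x); rewrite /= !TK; split=> //; apply: (can_inj T'K).
  by rewrite -[T u]scale1r linT' !TK scale1r.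
exists m, f, (T \o w); split=> // i; have [Lw wL free] := fw i; split=> /=.
- by rewrite TK.
- move=> v /wL[N [a Na]]; exists N, a; apply: (can_inj T'K).
  by rewrite !T'Z TK.
- move=> a; rewrite -TZ => aw; apply: free; apply: (can_inj TK).
  by rewrite aw T0.
Qed.

Lemma line_of_preimage v : T' @^-1` line_of v = line_of (T v).
Proof.
apply/seteqP; split=> [u [a _ /= e]|_ [a _ <-]]; exists a => //.
  by rewrite -TZ e T'K.
by rewrite T'Z TK.
Qed.

End MovedLines.

(** With x = x0/x2 and y = x3/x2, points of S satisfy x4/x2 = -x (x + y). This is the linear
    extension of (x, y) |-> (s x + b, s y), the last entry being -(s x + b) (s x + b + s y)
    expanded; the intended [t] is the inverse of [s]. *)
Definition shear (R : comNzRingType) (b t s : R) (v : 'rV[R]_5) : 'rV[R]_5 :=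
  let x i := v 0 (inord i) in
  vec5 (s * x 0%N + b * x 2%N) (t * x 1%N) (x 2%N) (s * x 3%N)
    (s ^+ 2 * x 4%N - (b * s * x 0%N) *+ 2 - b * s * x 3%N - b ^+ 2 * x 2%N).

Lemma shear_vec5 (R : comNzRingType) (b t s x0 x1 x2 x3 x4 : R) :
  shear b t s (vec5 x0 x1 x2 x3 x4) =
  vec5 (s * x0 + b * x2) (t * x1) x2 (s * x3)
    (s ^+ 2 * x4 - (b * s * x0) *+ 2 - b * s * x3 - b ^+ 2 * x2).
Proof. by rewrite /shear !vec5E. Qed.

Lemma shear_linear (R : comNzRingType) (b t s a : R) u v :
  shear b t s (a *: u + v) = a *: shear b t s u + shear b t s v.
Proof.
apply: rV5P; do 5?case=> [|] //; rewrite [RHS]mxE [X in _ = X + _]mxE /shear;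
  rewrite !vec5E !mxE => _; ring.
Qed.

(** The parameters compose by the semidirect group law, with [s] in the place of the inverse of
    [t]. *)
Lemma shear_comp (R : comNzRingType) (b t s b' t' s' : R) v :
  shear b t s (shear b' t' s' v) = shear (b + s * b') (t * t') (s * s') v.
Proof.
by rewrite (vec5_eta v) !shear_vec5; congr vec5; ring.
Qed.

Lemma shear1 (R : comNzRingType) (v : 'rV[R]_5) : shear 0 1 1 v = v.
Proof.
by rewrite {1}(vec5_eta v) shear_vec5 [RHS]vec5_eta; congr vec5; ring.
Qed.

Lemma shearK (R : comNzRingType) (b t s : R) :
  t * s = 1 -> cancel (shear b t s) (shear (- (t * b)) s t).
Proof.
move=> ts v; rewrite shear_comp addNr ts [s * t]mulrC ts; exact: shear1.
Qed.

Lemma shearVK (R : comNzRingType) (b t s : R) :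
  t * s = 1 -> cancel (shear (- (t * b)) s t) (shear b t s).
Proof.
move=> ts v; rewrite shear_comp mulrN mulrA [s * t]mulrC ts.
by rewrite mul1r subrr; exact: shear1.
Qed.

Lemma shear_map (R R' : comNzRingType) (f : {rmorphism R -> R'}) b t s v :
  map_mx f (shear b t s v) = shear (f b) (f t) (f s) (map_mx f v).
Proof.
rewrite (vec5_eta v) map_vec5 !shear_vec5 map_vec5.
by congr vec5; rewrite ?(rmorphB, rmorphD, rmorphM, rmorphXn, rmorphMn).
Qed.

(** The two quadrics get multiplied by [s ^+ 2] and by [t * s]. *)
Lemma shear_quadrics (R : comNzRingType) (b t s : R) v :
  t * s = 1 -> quadrics_vanish v -> quadrics_vanish (shear b t s v).
Proof.
move=> ts; rewrite (vec5_eta v) shear_vec5 !quadrics_vec5 => -[e1 e2].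
split; last by rewrite mulrACA ts mul1r.
by rewrite -(mulr0 (s ^+ 2)) -e1; ring.
Qed.

Section Action.
Variables (k : fieldType) (A : comAlgType k).
Implicit Types (g h : Ga_rtimes_Gm k A) (L : surfaceS k A).

Definition unit_of g : A := (sval g.2).1.
Definition unitV_of g : A := (sval g.2).2.
Definition shift_of g : A := g.1.

Lemma unit_ofV g : unit_of g * unitV_of g = 1.
Proof. by rewrite /unit_of /unitV_of; case: g => ? [[? ?] /= /eqP]. Qed.

Lemma Ga_rtimes_Gm_eq g h :
  shift_of g = shift_of h -> unit_of g = unit_of h ->
  unitV_of g = unitV_of h -> g = h.
Proof.
case: g h => b [[t s] p] [b' [[t' s'] p']]; rewrite /unit_of /unitV_of /=.
by move=> /= -> e1 e2; congr pair; apply: eq_exist; rewrite e1 e2.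
Qed.

Definition shear_by g := shear (shift_of g) (unit_of g) (unitV_of g).
Definition unshear_by g :=
  shear (- (unit_of g * shift_of g)) (unitV_of g) (unit_of g).

Lemma shear_byK g : cancel (shear_by g) (unshear_by g).
Proof. exact: shearK (unit_ofV g). Qed.

Lemma unshear_byK g : cancel (unshear_by g) (shear_by g).
Proof. exact: shearVK (unit_ofV g). Qed.

Lemma unshear_by_line g L : is_line (unshear_by g @^-1` sval (sval L)).
Proof.
apply: (is_line_preimage _ _ (@shear_byK g) (@unshear_byK g)) (svalP (sval L)).
  exact: shear_linear.
exact: shear_linear.
Qed.

Lemma unshear_by_equations g L :
  S_equations (exist _ _ (unshear_by_line g L) : projective_space k 4 A).
Proof.
move=> v /= /(svalP L) q; rewrite -(unshear_byK g v).
exact: shear_quadrics (unit_ofV g) q.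
Qed.

Definition shear_act g L : surfaceS k A :=
  exist _ _ (@unshear_by_equations g L).

Lemma shear_act_spans g L v : spans L v -> spans (shear_act g L) (shear_by g v).
Proof.
rewrite /spans /= => ->.
apply: line_of_preimage (@shear_byK g) (@unshear_byK g) v; exact: shear_linear.
Qed.

End Action.

Lemma shear_by_mul (k : fieldType) (A : comAlgType k) (g h : Ga_rtimes_Gm k A) v :
  shear_by (gmul g h) v = shear_by g (shear_by h v).
Proof. by rewrite /shear_by shear_comp. Qed.

Lemma unshear_by_mul (k : fieldType) (A : comAlgType k) (g h : Ga_rtimes_Gm k A) v :
  unshear_by (gmul g h) v = unshear_by h (unshear_by g v).
Proof.
apply: (can_inj (@shear_byK _ _ (gmul g h))).
by rewrite unshear_byK shear_by_mul !unshear_byK.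
Qed.

Lemma shear_by_map (k : fieldType) (A B : comAlgType k) (f : {lrmorphism A -> B})
    (g : Ga_rtimes_Gm k A) v :
  map_mx f (shear_by g v) = shear_by (pmap f g) (map_mx f v).
Proof. exact: shear_map. Qed.

Lemma unshear_by_map (k : fieldType) (A B : comAlgType k)
    (f : {lrmorphism A -> B}) (g : Ga_rtimes_Gm k A) v :
  map_mx f (unshear_by g v) = unshear_by (pmap f g) (map_mx f v).
Proof. by rewrite /unshear_by shear_map rmorphN rmorphM. Qed.

Lemma shear_act_map (k : fieldType) (A B : comAlgType k) (f : {lrmorphism A -> B})
    (g : Ga_rtimes_Gm k A) (L : surfaceS k A) :
  pmap f (shear_act g L) = shear_act (pmap f g) (pmap f L).
Proof.
apply: surfaceS_eq; rewrite /=; set L0 := sval (sval L).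
apply/seteqP; split.
  apply: rspan_min.
    apply: submodule_preimage; last exact: rspan_submodule.
    exact: shear_linear.
  by move=> _ [v Lv <-]; apply: rspan_gen; exists (unshear_by g v) => //;
    rewrite unshear_by_map.
(* Moving [shear_by] to the other side leaves an inclusion out of a base change, which can be tested
   on generators. *)
suff H : base_change f L0 `<=`
    shear_by (pmap f g) @^-1` base_change f (unshear_by g @^-1` L0).
  by move=> v /= /H /=; rewrite unshear_byK.
apply: rspan_min.
  apply: submodule_preimage; last exact: rspan_submodule.
  exact: shear_linear.
move=> _ [v Lv <-]; apply: rspan_gen; exists (shear_by g v).
  by rewrite /= shear_byK.
by rewrite shear_by_map.
Qed.

Lemma shear_act_is_action (k : fieldType) : is_action (@shear_act k).
Proof.
split=> [A L|A g h L|A B f g L]; last exact: shear_act_map.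
  apply: surfaceS_eq; apply/funext => v /=; congr (sval (sval L) _).
  by rewrite /unshear_by /= mul1r oppr0; exact: shear1.
apply: surfaceS_eq; apply/funext => v /=; congr (sval (sval L) _).
exact: unshear_by_mul.
Qed.

(** * The base point x = 0, t = 1 and its open orbit *)

Lemma base_quadrics (R : comNzRingType) : quadrics_vanish (vec5 0 1 1 1 0 : 'rV[R]_5).
Proof. by apply/quadrics_vec5; rewrite !expr2 !mulr0 !mulr1 !addr0. Qed.

Lemma base_coord (R : comNzRingType) :
  (vec5 0 1 1 1 0 : 'rV[R]_5) 0 (inord 2) = 1.
Proof. by rewrite vec5E. Qed.

Definition base_point (k : fieldType) (A : comAlgType k) : surfaceS k A :=
  point (@base_quadrics A) (@base_coord A).

Lemma base_point_map (k : fieldType) (A B : comAlgType k)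
    (f : {lrmorphism A -> B}) : pmap f (base_point A) = base_point B.
Proof.
apply: (@spans_eq _ _ _ _ (vec5 0 1 1 1 0)); last exact: point_spans.
have := spans_map f (point_spans (@base_quadrics A) (@base_coord A)).
by rewrite map_vec5 rmorph0 rmorph1.
Qed.

Lemma base_orbit_spans (k : fieldType) (A : comAlgType k) (g : Ga_rtimes_Gm k A) :
  spans (shear_act g (base_point A))
    (vec5 (shift_of g) (unit_of g) 1 (unitV_of g)
       (- (shift_of g * (shift_of g + unitV_of g)))).
Proof.
have := shear_act_spans g (point_spans (@base_quadrics A) (@base_coord A)).
rewrite /shear_by shear_vec5 /spans => ->; congr (line_of (vec5 _ _ _ _ _)); ring.
Qed.

(** If x2 = 1, the second quadric makes x1 and x3 mutually inverse, x0 is the translation part, and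
    the first quadric determines x4. *)
Lemma base_orbitP (k : fieldType) (A : comAlgType k) (L : surfaceS k A) :
  range (fun g : Ga_rtimes_Gm k A => shear_act g (base_point A)) L <->
  exists v, sval (sval L) v /\ v 0 (inord 2) = 1.
Proof.
split=> [[g _ <-]|[v [Lv v2]]].
  have sg := base_orbit_spans g; eexists; split.
    by rewrite sg; exact: line_of_gen.
  by rewrite vec5E.
have sv := spans_mem Lv v2; have := spans_quadrics sv.
rewrite (vec5_eta v) v2 quadrics_vec5 expr1n mul1r => -[e1 /eqP e2].
exists (v 0 (inord 0), exist _ (v 0 (inord 1), v 0 (inord 3)) e2) => //.
apply: (@spans_eq _ _ _ _ v) => //; rewrite /spans base_orbit_spans.
rewrite [in RHS](vec5_eta v) v2 /shift_of /unit_of /unitV_of /=.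
congr (line_of (vec5 _ _ _ _ _)).
by apply/eqP; rewrite eq_sym -subr_eq0 opprK -e1; apply/eqP; ring.
Qed.

(** The orbit is the locus where x2 is invertible. Its ideal is generated by the x2-coordinates of
    all vectors of the line, which need not be free. *)
Lemma base_orbit_open (k : fieldType) :
  open_subfunctor (fun A => range (fun g : Ga_rtimes_Gm k A =>
    shear_act g (base_point A))).
Proof.
move=> A L; exists [set v 0 (inord 2) | v in sval (sval L)] => B f.
rewrite base_orbitP; split=> [[v [[m [c [x [Lx ->]]]]]]|[m [c [x [Ix e]]]]].
  rewrite summxE => e; exists m, c, (fun i => x i 0 (inord 2)); split; last first.
    by rewrite -e; apply: eq_bigr => i _; rewrite mxE.
  move=> i; have [w Lw <-] := Lx i; exists (w 0 (inord 2)); last by rewrite mxE.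
  by exists w.
have /choice[w Hw] : forall i, exists w, sval (sval L) w /\ f (w 0 (inord 2)) = x i.
  by move=> i; have [_ [w Lw <-] <-] := Ix i; exists w.
exists (\sum_i c i *: map_mx f (w i)); split.
  exists m, c, (fun i => map_mx f (w i)); split=> // i.
  by exists (w i) => //; have [] := Hw i.
rewrite summxE -e; apply: eq_bigr => i _; rewrite !mxE.
by have [_ ->] := Hw i.
Qed.

Lemma base_orbit_inj (k : fieldType) (A : comAlgType k) :
  injective (fun g : Ga_rtimes_Gm k A => shear_act g (base_point A)).
Proof.
move=> g h e; have := base_orbit_spans g; rewrite e => gh.
have := spans_scale gh (base_orbit_spans h) (i := inord 2).
rewrite !vec5E => /(_ erefl); rewrite scale1r => /rowP E.
by apply: Ga_rtimes_Gm_eq;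
  [have := E (inord 0) | have := E (inord 1) | have := E (inord 3)];
  rewrite !vec5E.
Qed.

Theorem surfaceS_Ga_rtimes_Gm (k : fieldType) :
  equivariant_compactification (Ga_rtimes_Gm k) (surfaceS k).
Proof.
exists (@shear_act k), (fun A => range (fun g => shear_act g (base_point A))),
  (fun A g => shear_act g (base_point A)).
have [_ actM act_map] := shear_act_is_action k.
split=> //.
- exact: shear_act_is_action.
- exact: base_orbit_open.
- by move=> A B f g; rewrite act_map base_point_map.
- by move=> A; split=> //; exact: base_orbit_inj.
Qed.

(** * Dual numbers *)

Definition dual (k : fieldType) (A : comAlgType k) : Type := (A * A)%type.

Section Dual.
Variables (k : fieldType) (A : comAlgType k).
Implicit Types x y z : dual A.

HB.instance Definition _ := GRing.Lmodule.copy (dual A) (A * A)%type.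

Definition dual_one : dual A := (1, 0).
Definition dual_mul x y : dual A := (x.1 * y.1, x.1 * y.2 + x.2 * y.1).

Fact dual_mulA : associative dual_mul.
Proof. by move=> x y z; congr pair; rewrite /=; ring. Qed.
Fact dual_mulC : commutative dual_mul.
Proof. by move=> x y; congr pair; rewrite /=; ring. Qed.
Fact dual_mul1 : left_id dual_one dual_mul.
Proof. by move=> [x y]; congr pair; rewrite /=; ring. Qed.
Fact dual_mulDl : left_distributive dual_mul +%R.
Proof. by move=> x y z; congr pair; rewrite /=; ring. Qed.
Fact dual_one_neq0 : dual_one != 0.
Proof. by apply/eqP => -[/eqP]; rewrite oner_eq0. Qed.

HB.instance Definition _ := GRing.Zmodule_isComNzRing.Build (dual A)
  dual_mulA dual_mulC dual_mul1 dual_mulDl dual_one_neq0.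

Fact dual_scaleAl (a : k) x y : a *: (x * y) = (a *: x : dual A) * y.
Proof.
congr pair; rewrite /=; first exact: scalerAl.
by rewrite -!scalerAl -scalerDr.
Qed.

HB.instance Definition _ :=
  GRing.Lmodule_isLalgebra.Build k (dual A) dual_scaleAl.
HB.instance Definition _ := GRing.Lalgebra_isComAlgebra.Build k (dual A).

Lemma dualE x y : x * y = (x.1 * y.1, x.1 * y.2 + x.2 * y.1).
Proof. by []. Qed.

Definition eps : dual A := (0, 1).

Lemma eps_sq : eps * eps = 0.
Proof. by congr pair; rewrite /=; ring. Qed.

End Dual.
Arguments eps {k A}.

(** * Evaluation of dual numbers at a square-zero element *)

Section DualEval.
Variables (k : fieldType) (A B : comAlgType k) (f : {lrmorphism A -> B}) (e : B).
Hypothesis ee : e * e = 0.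

Definition dual_eval_fun (x : dual A) : B := f x.1 + f x.2 * e.
(** The proof of [e * e = 0] is made an argument so that the morphism structures below, which rely
    on it, attach to this term. *)
Definition dual_eval_key of e * e = 0 := dual_eval_fun.
Local Notation ev := (dual_eval_key ee).

Fact dual_eval_zmod : zmod_morphism ev.
Proof. by move=> x y; rewrite /dual_eval_key /dual_eval_fun /= !rmorphB; ring. Qed.

Fact dual_eval_monoid : monoid_morphism ev.
Proof.
rewrite /dual_eval_key /dual_eval_fun; split=> [|x y].
  by rewrite /= rmorph1 rmorph0; ring.
rewrite /= rmorphD !rmorphM.
rewrite -[RHS](subr0) -(mulr0 (f x.2 * f y.2)) -ee; ring.
Qed.

Fact dual_eval_scale : scalable ev.
Proof.
by move=> a x; rewrite /dual_eval_key /dual_eval_fun /= !linearZ /= scalerDr scalerAl.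
Qed.

HB.instance Definition _ := GRing.isZmodMorphism.Build (dual A) B ev dual_eval_zmod.
HB.instance Definition _ := GRing.isMonoidMorphism.Build (dual A) B ev dual_eval_monoid.
HB.instance Definition _ := GRing.isScalable.Build k (dual A) B *:%R ev dual_eval_scale.

Definition dual_eval : {lrmorphism dual A -> B} := ev.

Lemma dual_evalE x : dual_eval x = f x.1 + f x.2 * e.
Proof. by []. Qed.

End DualEval.

Section DualConst.
Variables (k : fieldType) (A : comAlgType k).

Definition dual_const_fun (x : A) : dual A := (x, 0).

Fact dual_const_zmod : zmod_morphism dual_const_fun.
Proof. by move=> x y; congr pair; rewrite /= subr0. Qed.
Fact dual_const_monoid : monoid_morphism dual_const_fun.
Proof. by split=> // x y; congr pair; rewrite /=; ring. Qed.
Fact dual_const_scale : scalable dual_const_fun.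
Proof. by move=> a x; congr pair; rewrite /= scaler0. Qed.

HB.instance Definition _ := GRing.isZmodMorphism.Build A (dual A) dual_const_fun dual_const_zmod.
HB.instance Definition _ := GRing.isMonoidMorphism.Build A (dual A) dual_const_fun dual_const_monoid.
HB.instance Definition _ := GRing.isScalable.Build k A (dual A) *:%R dual_const_fun dual_const_scale.

Definition dual_const : {lrmorphism A -> dual A} := dual_const_fun.

End DualConst.
Arguments dual_const {k A}.

Lemma dual_eta (k : fieldType) (A : comAlgType k) (x : dual A) :
  x = dual_const x.1 + eps * dual_const x.2.
Proof. by case: x => a b; congr pair; rewrite /=; ring. Qed.

(** * Evaluation of polynomials in an algebra *)

Section PolyEval.
Variables (k : fieldType) (A : comAlgType k) (a : A).

Definition poly_eval_fun (p : {poly k}) : A := horner_alg a p.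

Fact poly_eval_zmod : zmod_morphism poly_eval_fun.
Proof. by move=> p q; rewrite /poly_eval_fun rmorphB. Qed.
Fact poly_eval_monoid : monoid_morphism poly_eval_fun.
Proof.
by split=> [|p q]; rewrite /poly_eval_fun; [exact: rmorph1 | exact: rmorphM].
Qed.
Fact poly_eval_scale : scalable poly_eval_fun.
Proof.
move=> c p; rewrite /poly_eval_fun -mul_polyC rmorphM /= horner_algC.
by rewrite mulr_algl.
Qed.

HB.instance Definition _ := GRing.isZmodMorphism.Build {poly k} A poly_eval_fun poly_eval_zmod.
HB.instance Definition _ := GRing.isMonoidMorphism.Build {poly k} A poly_eval_fun poly_eval_monoid.
HB.instance Definition _ := GRing.isScalable.Build k {poly k} A *:%R poly_eval_fun poly_eval_scale.

Definition poly_eval : {lrmorphism {poly k} -> A} := poly_eval_fun.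

Lemma poly_evalC c : poly_eval c%:P = c%:A.
Proof. exact: horner_algC. Qed.

Lemma poly_evalX : poly_eval 'X = a.
Proof. exact: horner_algX. Qed.

End PolyEval.

Lemma poly_eval_horner (k : fieldType) (c : k^o) (p : {poly k}) :
  poly_eval c p = p.[c].
Proof.
elim/poly_ind: p => [|p a IH]; first by rewrite rmorph0 horner0.
rewrite rmorphD rmorphM /= poly_evalC poly_evalX hornerMXaddC -IH.
by rewrite /GRing.scale /= mulr1.
Qed.

(** * Tangent vectors of the surface *)

(* x = x0/x2 and t = x3/x2, rescaled to x1 = 1 so that t = 0 is allowed. *)
Definition chart1 (R : comNzRingType) (x t : R) : 'rV[R]_5 :=
  vec5 (x * t) 1 t (t ^+ 2) (- (x * t * (x + t))).

Lemma chart1_quadrics (R : comNzRingType) (x t : R) : quadrics_vanish (chart1 x t).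
Proof. by apply/quadrics_vec5; split; ring. Qed.

Lemma chart1_coord (R : comNzRingType) (x t : R) : chart1 x t 0 (inord 1) = 1.
Proof. by rewrite vec5E. Qed.

Definition chart1_point (k : fieldType) (A : comAlgType k) (x t : A) : surfaceS k A :=
  point (chart1_quadrics x t) (chart1_coord x t).

Lemma chart1_point_spans (k : fieldType) (A : comAlgType k) (x t : A) :
  spans (chart1_point x t) (chart1 x t).
Proof. exact: point_spans. Qed.

Lemma chart1_map (R R' : comNzRingType) (f : {rmorphism R -> R'}) (x t : R) :
  map_mx f (chart1 x t) = chart1 (f x) (f t).
Proof. by rewrite map_vec5 /chart1 rmorph1 rmorphN rmorphXn !rmorphM rmorphD. Qed.

Lemma chart1_point_map (k : fieldType) (A B : comAlgType k) (f : {lrmorphism A -> B})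
    (x t : A) : pmap f (chart1_point x t) = chart1_point (f x) (f t).
Proof.
apply: (spans_eq (spans_map f (chart1_point_spans x t))).
by rewrite chart1_map; exact: chart1_point_spans.
Qed.

Lemma chart1_point_inj (k : fieldType) (A : comAlgType k) (x t x' t' : A) :
  chart1_point x t = chart1_point x' t' -> x * t = x' * t' /\ t = t'.
Proof.
move=> e; have := chart1_point_spans x t; rewrite e => /spans_scale.
move=> /(_ _ _ (chart1_point_spans x' t') (chart1_coord _ _)).
rewrite vec5E scale1r => /rowP E.
by have := E (inord 0); have := E (inord 2); rewrite !vec5E.
Qed.

(* A flow is a vector field: [e] with [e * e = 0] is the infinitesimal time, and
   naturality reduces everything to [e = eps] in the dual numbers. *)
Definition flow (k : fieldType) : Type :=
  forall (A : comAlgType k) (e : A), e * e = 0 -> surfaceS k A -> surfaceS k A.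

Definition is_flow (k : fieldType) (F : flow k) : Prop :=
  (forall (A : comAlgType k) (e : A) (ee : e * e = 0) s, e = 0 -> F A e ee s = s) /\
  (forall (A B : comAlgType k) (f : {lrmorphism A -> B}) (e : A) (e' : B)
     (ee : e * e = 0) (ee' : e' * e' = 0) s,
     f e = e' -> pmap f (F A e ee s) = F B e' ee' (pmap f s)).

(** A section of [f] that is a mere function suffices: it lifts the coefficients of a combination of
    images. *)
Lemma is_line_lift (R R' : comNzRingType) (f : {rmorphism R -> R'}) (g : R' -> R) n
    (L : set 'rV[R]_n) v :
  cancel g f -> submodule L -> base_change f L v -> exists2 u, L u & map_mx f u = v.
Proof.
move=> gK sL [m [c [x [Lx ->]]]].
have /choice[y yP] : forall i, exists y, L y /\ map_mx f y = x i.
  by move=> i; have [y Ly <-] := Lx i; exists y.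
exists (\sum_i g (c i) *: y i).
  by apply: submodule_sum => // i; have [] := yP i.
rewrite map_mx_sum; apply: eq_bigr => i _.
by have [_ <-] := yP i; rewrite map_mxZ /= gK.
Qed.

Section Tangent.
Variables (k : fieldType) (F : flow k).
Hypothesis FF : is_flow F.

(** The flow is run over the dual numbers for the universal time [eps]. The result reduces to [s] at
    eps = 0, so it is spanned by some v + eps d with coordinate [i] equal to 1; naturality carries
    this to every time [e]. *)
Lemma flow_tangent (A : comAlgType k) (s : surfaceS k A) v i :
  spans s v -> v 0 i = 1 -> exists d : 'rV[A]_5,
  [/\ d 0 i = 0,
      let v j := v 0 (inord j) in let d j := d 0 (inord j) in
      d 2%N * v 4%N + v 2%N * d 4%N + (v 0%N * d 0%N) *+ 2 + v 0%N * d 3%N + d 0%N * v 3%N = 0 /\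
      v 1%N * d 3%N + d 1%N * v 3%N = (v 2%N * d 2%N) *+ 2
    & forall (B : comAlgType k) (f : {lrmorphism A -> B}) (e : B) (ee : e * e = 0),
      spans (F ee (pmap f s)) (map_mx f v + e *: map_mx f d)].
Proof.
have [F0 Fnat] := FF; move=> sv vi1.
pose s' := F (@eps_sq k A) (pmap dual_const s).
pose p := dual_eval (idfun : {lrmorphism A -> A}) (mulr0 0).
have cK : cancel (dual_const : A -> dual A) p.
  by move=> a; rewrite dual_evalE /= mulr0 addr0.
have ps' : pmap p s' = s.
  rewrite (Fnat _ _ _ _ 0 _ (mulr0 0)); last by rewrite dual_evalE /= mulr0 addr0.
  rewrite F0 //; apply: (@spans_eq _ _ _ _ v) => //.
  have := spans_map p (spans_map dual_const sv); congr spans.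
  by apply/rowP => j; rewrite !mxE cK.
have [u Lu pu] : exists2 u, sval (sval s') u & map_mx p u = v.
  apply: (is_line_lift cK); first by have [[]] := svalP (sval s').
  by have := line_of_gen v; rewrite -sv -{1}ps'.
have p1 (x : dual A) : p x = x.1 by rewrite dual_evalE /= mulr0 addr0.
have ui1 : (u 0 i).1 = 1 by rewrite -p1 -vi1 -pu mxE.
(* This scalar is the inverse of [u 0 i], whose constant part is 1. *)
pose w := ((1, - (u 0 i).2) : dual A) *: u.
have wi1 : w 0 i = 1.
  by rewrite mxE dualE /= ui1 !mulr1 mul1r addrN.
have Lw : sval (sval s') w.
  have [[[L0 LD] _] _] := svalP (sval s').
  by rewrite /w -[_ *: u]addr0; apply: LD.
have sw := spans_mem Lw wi1.
have w1 j : (w 0 j).1 = v 0 j by rewrite mxE dualE /= mul1r -pu mxE p1.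
have [d w2] : exists d : 'rV[A]_5, forall j, (w 0 j).2 = d 0 j.
  by exists (\row_j (w 0 j).2) => j; rewrite [RHS]mxE.
clearbody w; exists d; split.
- by rewrite -w2 wi1.
(* The eps-parts of the quadrics are the linearised equations for [d]. *)
- have [/(congr1 snd) e1 /(congr1 snd) e2] := spans_quadrics sw.
  move: e1 e2; rewrite /= !w1 !w2 => e1 e2; split; first by rewrite -[RHS]e1; ring.
  by apply/eqP; rewrite -subr_eq0; apply/eqP; rewrite -[RHS]e2; ring.
move=> B f e ee; pose q := dual_eval f ee.
have := spans_map q sw; rewrite (Fnat _ _ _ _ e _ ee); last first.
  by rewrite dual_evalE /= rmorph0 rmorph1 add0r mul1r.
have -> : pmap q (pmap dual_const s) = pmap f s.
  apply: spans_eq (spans_map _ (spans_map _ sv)) _.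
  have := spans_map f sv; congr spans; apply/rowP => j.
  by rewrite !mxE dual_evalE /= rmorph0 mul0r addr0.
congr spans; apply/rowP => j.
by rewrite !mxE dual_evalE w1 w2 mulrC.
Qed.

End Tangent.

(** * Global vector fields *)

Lemma natf_neq0_char0 (k : fieldType) (char0 : [pchar k] =i pred0) (n : nat) :
  (n.+1%:R : k) != 0.
Proof. by move/pcharf0P: char0 => ->. Qed.

(** [p * q] vanishes at every scalar, and in characteristic 0 the integers supply more distinct
    roots than its degree permits. *)
Lemma poly_eq0_generic (k : fieldType) (char0 : [pchar k] =i pred0)
    (p q : {poly k}) :
  q != 0 -> (forall c, q.[c] != 0 -> p.[c] = 0) -> p = 0.
Proof.
move=> q0 pq; apply/eqP; apply: contraT => p0.
have pq0 : p * q != 0 by rewrite mulf_neq0.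
have := max_poly_roots pq0 (rs := [seq i%:R | i <- iota 0 (size (p * q))]).
rewrite size_map size_iota ltnn => -> //; last first.
  rewrite map_inj_uniq ?iota_uniq // => i j.
  wlog ij : i j / (i <= j)%N => [H e|/esym/eqP].
    by case/orP: (leq_total i j) => ij; [|symmetry]; apply: H.
  rewrite -subr_eq0 -natrB //; move/pcharf0P: char0 => -> ji.
  by apply/eqP; rewrite eqn_leq ij -subn_eq0.
apply/allP => _ /mapP[i _ ->]; rewrite rootE hornerM.
by have [->|/pq ->] := eqVneq q.[i%:R] 0; rewrite ?mulr0 ?mul0r.
Qed.

Lemma poly_eq_off0 (k : fieldType) (char0 : [pchar k] =i pred0) (p q : {poly k}) :
  (forall c, c != 0 -> p.[c] = q.[c]) -> p = q.
Proof.
move=> pq; apply/eqP; rewrite -subr_eq0; apply/eqP.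
apply: (poly_eq0_generic char0 (q := 'X)); first by rewrite polyX_eq0.
by move=> c; rewrite hornerX hornerD hornerN => /pq ->; rewrite subrr.
Qed.

(** A pole of order at most [n] at infinity bounds the degree of [p] by [n], and [r] is the reversal
    of [p]. *)
Lemma coef_reciprocal (k : fieldType) (char0 : [pchar k] =i pred0) n
    (p r : {poly k}) :
  (forall c, c != 0 -> c ^+ n * p.[c^-1] = r.[c]) ->
  forall i, p`_i = if (i <= n)%N then r`_(n - i) else 0.
Proof.
move=> pr i; set s := size p; pose N := (n + s)%N.
have [iN|Ni] := leqP i N; last first.
  have si : (s <= i)%N by rewrite (leq_trans _ (ltnW Ni)) // leq_addl.
  by rewrite nth_default // leqNgt (leq_ltn_trans _ Ni) ?leq_addr.
(* The extra factor X^s, with s the size of [p], clears all negative exponents, so that two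
   polynomials are compared off 0. *)
have : \poly_(j < N.+1) p`_(N - j) = 'X^s * r.
  apply: (poly_eq_off0 char0) => c c0.
  rewrite hornerM hornerXn -pr // mulrA -exprD addnC -/N.
  rewrite [p.[_]](@horner_coef_wide _ N.+1); last by rewrite -/s /N; lia.
  rewrite horner_poly mulr_sumr (reindex_inj rev_ord_inj) /=.
  apply: eq_bigr => j _; rewrite subSS subKn -1?ltnS // mulrCA; congr (_ * _).
  have jN : (j <= N)%N by rewrite -ltnS.
  have -> : c ^+ N = c ^+ (N - j) * c ^+ j by rewrite -exprD subnK.
  by rewrite exprVn mulfK // expf_neq0.
move=> /polyP/(_ (N - i)%N); rewrite coef_poly ltnS leq_subr subKn // => ->.
rewrite coefXnM; have [ni|ni] := leqP i n.
  by rewrite ifF; [congr (_`_ _); rewrite /N|apply/negbTE; rewrite -leqNgt /N]; lia.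
by rewrite ifT // /N; lia.
Qed.

Lemma horner3 (k : fieldType) (p : {poly k}) (x : k) :
  (forall i, (2 < i)%N -> p`_i = 0) ->
  p.[x] = p`_0 + p`_1 * x + p`_2 * x ^+ 2.
Proof.
move=> p3; rewrite (horner_coef_wide _ (n := 3)); last exact/leq_sizeP.
by rewrite !big_ord_recr big_ord0 /= add0r expr0 mulr1 expr1.
Qed.

(** * Interpolation in a parameter *)

Section Interpolation.
Variables (k : fieldType) (char0 : [pchar k] =i pred0) (f : k -> {poly k}).

(** The values at c = 1, -1, 2 recover the coefficients of a quadratic in c. As these values are
    polynomials in x, so are the coefficients. *)
Definition interp1 : {poly k} := 2^-1 *: (f 1 - f (-1)).
Definition interp2 : {poly k} :=
  3^-1 *: (f 2 - f 1 + f (-1) - 2^-1 *: (f 1 + f (-1))).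
Definition interp0 : {poly k} := 2^-1 *: (f 1 + f (-1)) - interp2.

Lemma interpP (x a0 a1 a2 : k) :
  (forall c, c != 0 -> (f c).[x] = a0 + c * a1 + c ^+ 2 * a2) ->
  [/\ interp0.[x] = a0, interp1.[x] = a1 & interp2.[x] = a2].
Proof.
move=> fx; have n2 := natf_neq0_char0 char0 1; have n3 := natf_neq0_char0 char0 2.
have [f1 f2 f3] : [/\ (f 1).[x] = a0 + a1 + a2, (f (-1)).[x] = a0 - a1 + a2 &
    (f 2).[x] = a0 + 2 * a1 + 4 * a2].
  by split; rewrite fx ?oppr_eq0 ?oner_eq0 //; ring.
rewrite /interp0 /interp1 /interp2 !hornerE f1 f2 f3.
by split; field; rewrite ?n2 ?n3.
Qed.

End Interpolation.

(** * Fields regular along test curves *)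

Section FieldShape.
Variables (k : fieldType) (char0 : [pchar k] =i pred0) (Z Q : k -> k -> k).

(* With D the vector field, [Z] stands for D(x t) and [Q] for D(t), functions of
   the point (x, t) with t <> 0.  The curves lie in the chart x1 = 1, where
   x t = x0 and t = x2, respectively in the chart x3 = 1, where x/t = x0 and
   1/t = x2; [d0], [d2], [d4] are the components of D along the curve. *)
Definition regular_chart1 : Prop := forall v0 v2 v4 : {poly k},
  v0 ^+ 2 + v0 * v2 ^+ 2 + v2 * v4 = 0 ->
  exists d0 d2 d4 : {poly k},
    d2 * v4 + v2 * d4 + (v0 * d0) *+ 2 + v0 * (v2 * d2) *+ 2 + d0 * v2 ^+ 2 = 0 /\
    forall c, v2.[c] != 0 ->
      Z (v0.[c] / v2.[c]) v2.[c] = d0.[c] /\ Q (v0.[c] / v2.[c]) v2.[c] = d2.[c].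

Definition regular_chart3 : Prop := forall v0 v2 v4 : {poly k},
  v0 ^+ 2 + v0 + v2 * v4 = 0 ->
  exists d0 d2 d4 : {poly k},
    d2 * v4 + v2 * d4 + (v0 * d0) *+ 2 + d0 = 0 /\
    forall c, v2.[c] != 0 ->
      let x := v0.[c] / v2.[c] in let t := v2.[c]^-1 in
      v2.[c] ^+ 2 * (Z x t - 2 * x * Q x t) = d0.[c] /\
      - (v2.[c] ^+ 2 * Q x t) = d2.[c].

Hypotheses (reg1 : regular_chart1) (reg3 : regular_chart3).

(* The curve x = m, at t = 0 in the first chart and t = oo in the second. *)
Lemma vertical_shape m : exists q0 q1 q2 z0 z1 : k, forall t : k, t != 0 ->
  Q m t = q0 + t * q1 + t ^+ 2 * q2 /\ Z m t = z0 + t * z1 + t ^+ 2 * (m * q2).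
Proof.
have [|hz [hq [_ [_ E1]]]] :=
  reg1 (v0 := m *: 'X) (v2 := 'X) (v4 := - (m *: 'X * (m%:P + 'X))).
  by rewrite -mul_polyC; ring.
have [|d0 [d2 [d4 [e E3]]]] :=
  reg3 (v0 := m *: 'X) (v2 := 'X) (v4 := - (m%:P * (1 + m *: 'X))).
  by rewrite -mul_polyC; ring.
have {}E1 t : t != 0 -> Z m t = hz.[t] /\ Q m t = hq.[t].
  by move=> t0; have := E1 t; rewrite !hornerE mulfK //; apply.
(* Substituting t = 1/c compares the two expansions; [coef_reciprocal] then bounds the degrees in t
   by 2. *)
have {}E3 c : c != 0 -> c ^+ 2 * (hz - (2 * m) *: hq).[c^-1] = d0.[c] /\
    c ^+ 2 * (- hq).[c^-1] = d2.[c].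
  move=> c0; have := E3 c; rewrite /= !hornerE mulfK // => /(_ c0).
  have [|-> ->] := E1 c^-1; first by rewrite invr_eq0.
  by move=> [<- <-] /=; split; [field|ring].
have cz := coef_reciprocal char0 (fun c c0 => (E3 c c0).1).
have cq := coef_reciprocal char0 (fun c c0 => (E3 c c0).2).
have hq3 i : (2 < i)%N -> hq`_i = 0.
  by move=> i2; have := cq i; rewrite leqNgt i2 coefN => /eqP; rewrite oppr_eq0 => /eqP.
have hz3 i : (2 < i)%N -> hz`_i = 0.
  by move=> i2; have := cz i; rewrite leqNgt i2 coefB coefZ hq3 // mulr0 subr0.
(* At c = 0, that is t = oo, the tangency equation reduces to d0 = m d2. *)
have z2 : hz`_2 = m * hq`_2.
  have := cz 2%N; have := cq 2%N; rewrite /= coefB coefZ coefN => dq dz.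
  move: e => /(congr1 (horner^~ 0)); rewrite !hornerE !horner_coef0 /=.
  rewrite -dq -dz => /= e; apply/eqP; rewrite -subr_eq0; apply/eqP; rewrite -[RHS]e; ring.
exists hq`_0, hq`_1, hq`_2, hz`_0, hz`_1 => t t0.
have [-> ->] := E1 t t0; rewrite (horner3 _ hq3) (horner3 _ hz3) z2.
by split; ring.
Qed.

(* The curves t = c give polynomials in x; the curves x^2 t = c, with parameter
   1/x, cross the line x0 = x2 = x3 = 0 and bound the degrees. *)
Lemma regular_shape : exists u z0 z1 z2 e0 e1 e2 : k, forall x t : k, t != 0 ->
  Q x t = (u + 2 * z2 * x) * t + (e0 + e1 * x + e2 * x ^+ 2) * t ^+ 2 /\
  Z x t = (z0 + z1 * x + z2 * x ^+ 2) * t +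
          x * (e0 + e1 * x + e2 * x ^+ 2) * t ^+ 2.
Proof.
have /choice[q0 /choice[q1 /choice[q2 /choice[z0 /choice[z1 E]]]]] := vertical_shape.
have /choice[D HD] : forall c : k, exists D : {poly k} * {poly k}, c != 0 -> forall x,
    Z x c = D.1.[x] /\ Q x c = D.2.[x].
  move=> c; have [|d0 [d2 [d4 [_ Ec]]]] :=
    reg1 (v0 := c *: 'X) (v2 := c%:P) (v4 := - (c *: 'X * ('X + c%:P))).
    by rewrite -!mul_polyC; ring.
  exists (d0, d2) => c0 x; have := Ec x; rewrite !hornerE.
  by rewrite [c * x]mulrC mulfK //; apply.
(* Here x = 1/s and t = c s^2. The coefficient conditions are the tangency equation modulo X^2,
   which reads d2 = 2 d0 X; for c = 0 the zero polynomials are chosen. *)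
have /choice[G HG] : forall c : k, exists G : {poly k} * {poly k},
    [/\ G.2`_0 = 0, G.2`_1 = 2 * G.1`_0 & c != 0 -> forall s, s != 0 ->
       Z s^-1 (c * s ^+ 2) = G.1.[s] /\ Q s^-1 (c * s ^+ 2) = G.2.[s]].
  move=> c; have [->|c0] := eqVneq c 0.
    by exists (0, 0); split; rewrite /= ?coef0 ?mulr0 // eqxx.
  have [|d0 [d2 [d4 [e Ec]]]] :=
    reg1 (v0 := c *: 'X) (v2 := c *: 'X^2) (v4 := - (c%:P * (1 + c *: 'X^3))).
    by rewrite -!mul_polyC; ring.
  have d2E : d2 = 2%:P * d0 * 'X + (d4 + c *: ('X * d2) + c *: ('X^2 * d0)) * 'X^2.
    apply: (mulfI (_ : c%:P != 0)); first by rewrite polyC_eq0.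
    by apply/eqP; rewrite -subr_eq0; apply/eqP; rewrite -[RHS]oppr0 -[in RHS]e -!mul_polyC; ring.
  exists (d0, d2); split=> /=.
  - by rewrite d2E coefD coefMX coefMXn /= addr0.
  - by rewrite d2E coefD coefMX coefMXn /= addr0 coefCM.
  - move=> _ s s0; have := Ec s; rewrite !hornerZ hornerX hornerXn mulf_neq0 ?expf_neq0 // => /(_ isT).
    by have -> : c * s / (c * s ^+ 2) = s^-1 by field; rewrite c0 s0.
(* The coefficient functions of [vertical_shape] now appear along both families of curves, as
   quadratics in c. *)
have DZ x c : c != 0 -> (D c).1.[x] = z0 x + c * z1 x + c ^+ 2 * (x * q2 x).
  by move=> c0; have [<- _] := HD c c0 x; have [_ ->] := E x c c0.
have DQ x c : c != 0 -> (D c).2.[x] = q0 x + c * q1 x + c ^+ 2 * q2 x.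
  by move=> c0; have [_ <-] := HD c c0 x; have [-> _] := E x c c0.
have GZ s c : s != 0 -> c != 0 -> (G c).1.[s] =
    z0 s^-1 + c * (s ^+ 2 * z1 s^-1) + c ^+ 2 * (s ^+ 3 * q2 s^-1).
  move=> s0 c0; have [_ _ /(_ c0 s s0)[<- _]] := HG c.
  have [|_ ->] := E s^-1 (c * s ^+ 2); first by rewrite mulf_neq0 ?expf_neq0.
  by field.
have GQ s c : s != 0 -> c != 0 -> (G c).2.[s] =
    q0 s^-1 + c * (s ^+ 2 * q1 s^-1) + c ^+ 2 * (s ^+ 4 * q2 s^-1).
  move=> s0 c0; have [_ _ /(_ c0 s s0)[_ <-]] := HG c.
  have [|-> _] := E s^-1 (c * s ^+ 2); first by rewrite mulf_neq0 ?expf_neq0.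
  by ring.
pose Dz c := (D c).1; pose Dq c := (D c).2; pose Gz c := (G c).1; pose Gq c := (G c).2.
have IDz x := interpP char0 (f := Dz) (@DZ x).
have IDq x := interpP char0 (f := Dq) (@DQ x).
have IGz s s0 := interpP char0 (f := Gz) (fun c => @GZ s c s0).
have IGq s s0 := interpP char0 (f := Gq) (fun c => @GQ s c s0).
have {HG}[G0 G1 G2] : [/\ (interp0 Gq)`_0 = 0 /\ (interp0 Gq)`_1 = 2 * (interp0 Gz)`_0,
    (interp1 Gq)`_0 = 0 /\ (interp1 Gq)`_1 = 2 * (interp1 Gz)`_0 &
    (interp2 Gq)`_0 = 0 /\ (interp2 Gq)`_1 = 2 * (interp2 Gz)`_0].
  have H0 c : (Gq c)`_0 = 0 by have [] := HG c.
  have H1 c : (Gq c)`_1 = 2 * (Gz c)`_0 by have [] := HG c.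
  rewrite /interp0 /interp1 /interp2 !(coefD, coefN, coefZ) !H0 !H1.
  by do !split; ring.
(* A polynomial in x that becomes polynomial in s = 1/x after multiplication by s^n has degree at
   most n. The exponents 0, 0, 2, 2, 4, 3 used next are those in [GZ] and [GQ]. *)
have C (p r : {poly k}) n (g : k -> k) : (forall x, p.[x] = g x) ->
    (forall s, s != 0 -> r.[s] = s ^+ n * g s^-1) ->
    forall i, p`_i = if (i <= n)%N then r`_(n - i) else 0.
  by move=> pg rg; apply: coef_reciprocal => // c c0; rewrite rg // pg.
have c0z := C _ _ 0%N z0 (fun x => let: And3 e _ _ := IDz x in e)
  (fun s s0 => let: And3 e _ _ := IGz s s0 in etrans e (esym (mul1r _))).
have c0q := C _ _ 0%N q0 (fun x => let: And3 e _ _ := IDq x in e)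
  (fun s s0 => let: And3 e _ _ := IGq s s0 in etrans e (esym (mul1r _))).
have c1z := C _ _ 2%N z1 (fun x => let: And3 _ e _ := IDz x in e)
  (fun s s0 => let: And3 _ e _ := IGz s s0 in e).
have c1q := C _ _ 2%N q1 (fun x => let: And3 _ e _ := IDq x in e)
  (fun s s0 => let: And3 _ e _ := IGq s s0 in e).
have c2q := C _ _ 4%N q2 (fun x => let: And3 _ _ e := IDq x in e)
  (fun s s0 => let: And3 _ _ e := IGq s s0 in e).
have c2z := C _ _ 3%N q2 (fun x => let: And3 _ _ e := IDq x in e)
  (fun s s0 => let: And3 _ _ e := IGz s s0 in e).
have n2 := natf_neq0_char0 char0 1.
have q00 x : q0 x = 0.
  have [<- _ _] := IDq x; rewrite horner3 ?c0q /= ?G0.1 ?mul0r ?addr0 //.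
  by move=> i i2; rewrite c0q; case: i i2.
have Gq0 : interp0 Gq = 0.
  apply: (poly_eq_off0 char0) => s s0; rewrite horner0.
  by have [-> _ _] := IGq s s0.
have z00 x : z0 x = 0.
  have [_ /esym/eqP] := G0; rewrite Gq0 coef0 mulf_eq0 (negbTE n2) => /eqP Gz0.
  have [<- _ _] := IDz x; rewrite horner3 ?c0z /= ?Gz0 ?mul0r ?addr0 //.
  by move=> i i2; rewrite c0z; case: i i2.
have q1E x : q1 x = (interp1 Dq)`_0 + 2 * (interp1 Dz)`_2 * x.
  have [_ <- _] := IDq x; rewrite horner3; last first.
    by move=> i i2; rewrite c1q leqNgt i2.
  have -> : (interp1 Dq)`_1 = 2 * (interp1 Dz)`_2 by rewrite c1q c1z /= G1.2.
  have -> : (interp1 Dq)`_2 = 0 by rewrite c1q /= G1.1.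
  by rewrite mul0r addr0.
have z1E x : z1 x = (interp1 Dz)`_0 + (interp1 Dz)`_1 * x + (interp1 Dz)`_2 * x ^+ 2.
  have [_ <- _] := IDz x; rewrite horner3 // => i i2.
  by rewrite c1z leqNgt i2.
(* The expansions of Q and of Z compute this coefficient as 2 g and as g, where g is the constant
   term of [interp2 Gz]. *)
have q23 : (interp2 Dq)`_3 = 0.
  have h1 : (interp2 Dq)`_3 = 2 * (interp2 Gz)`_0 by rewrite c2q /= G2.2.
  have h2 : (interp2 Dq)`_3 = (interp2 Gz)`_0 by rewrite c2z.
  by apply: (addrI (interp2 Dq)`_3); rewrite addr0 [RHS]h1 mulr_natl mulr2n h2.
have q2E x : q2 x = (interp2 Dq)`_0 + (interp2 Dq)`_1 * x + (interp2 Dq)`_2 * x ^+ 2.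
  have [_ _ <-] := IDq x; rewrite horner3 // => i i2.
  by case: (eqVneq i 3%N) => [->//|i3]; rewrite c2z leqNgt ltn_neqAle eq_sym i3 i2.
exists (interp1 Dq)`_0, (interp1 Dz)`_0, (interp1 Dz)`_1, (interp1 Dz)`_2,
  (interp2 Dq)`_0, (interp2 Dq)`_1, (interp2 Dq)`_2 => x t t0.
have [-> ->] := E x t t0; rewrite q00 z00 q1E z1E q2E.
by split; ring.
Qed.

Lemma horner5 (c0 c1 c2 c3 c4 x : k) :
  (Poly [:: c0; c1; c2; c3; c4]).[x] =
  c0 + c1 * x + c2 * x ^+ 2 + c3 * x ^+ 3 + c4 * x ^+ 4.
Proof. by rewrite horner_Poly /=; ring. Qed.

(* The curves x + t = m cross the line x0 + x3 = x1 = x2 = 0 at t = oo. *)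
Lemma regular_field : exists a b : k, forall x t : k, t != 0 ->
  Q x t = b * t /\ Z x t = (a + 2 * b * x) * t.
Proof.
have [u [z0 [z1 [z2 [e0 [e1 [e2 E]]]]]]] := regular_shape.
(* [pq m] is Q along x + t = m, as a polynomial in t. *)
pose pq m := Poly [:: 0; u + 2 * z2 * m; e0 + e1 * m + e2 * m ^+ 2 - 2 * z2;
  - (e1 + 2 * e2 * m); e2].
have H m : [/\ (pq m)`_3 = 0, (pq m)`_4 = 0 & e1 = 0 -> e2 = 0 ->
    e0 = 3 * z2 /\
    m * - (e0 - 2 * z2) =
    - (2 * m * z2) - z1 + m * e0 - 2 * m * (e0 - 2 * z2) + 2 * (u + 2 * z2 * m)].
  have [|d0 [d2 [d4 [e E3]]]] :=
    reg3 (v0 := -1 + m *: 'X) (v2 := 'X) (v4 := m%:P * (1 - m *: 'X)).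
    by rewrite -mul_polyC; ring.
  have {}E3 c : c != 0 -> let t := c^-1 in let x := m - t in
      c ^+ 2 * (Z x t - 2 * x * Q x t) = d0.[c] /\ - (c ^+ 2 * Q x t) = d2.[c].
    move=> c0; have := E3 c; rewrite /= hornerX => /(_ c0).
    have -> : (-1 + m *: 'X).[c] = -1 + m * c by rewrite !hornerE.
    by have -> : (-1 + m * c) / c = m - c^-1 by field.
  (* Regularity at t = oo bounds the degree by 2, so the coefficients of t^3 and t^4 vanish. *)
  have cq i : (- pq m)`_i = if (i <= 2)%N then d2`_(2 - i) else 0.
    apply: (coef_reciprocal char0) => c c0; have [_ <-] := E3 c c0.
    have [|-> _] := E (m - c^-1) c^-1; first by rewrite invr_eq0.
    by rewrite hornerN horner5; ring.
  have := cq 3%N; have := cq 4%N; have := cq 2%N; rewrite !coefN !coef_Poly /=.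
  move=> dq /eqP; rewrite oppr_eq0 => /eqP c4 /eqP; rewrite oppr_eq0 => /eqP c3.
  split=> // e10 e20.
  (* This is Z - 2 x Q along the same curve when e1 = e2 = 0; its vanishing cubic coefficient gives
     e0 = 3 z2. *)
  pose pz := Poly [:: 0; z0 + z1 * m + z2 * m ^+ 2 - 2 * m * (u + 2 * z2 * m);
    - (2 * m * z2) - z1 + m * e0 - 2 * m * (e0 - 2 * z2) + 2 * (u + 2 * z2 * m);
    z2 - e0 + 2 * (e0 - 2 * z2); 0].
  have cz i : pz`_i = if (i <= 2)%N then d0`_(2 - i) else 0.
    apply: (coef_reciprocal char0) => c c0; have [<- _] := E3 c c0.
    have [|-> ->] := E (m - c^-1) c^-1; first by rewrite invr_eq0.
    by rewrite horner5 e10 e20; ring.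
  have := cz 3%N; have := cz 2%N; rewrite !coef_Poly /= => dz dz3.
  split; first by apply/eqP; rewrite -subr_eq0; apply/eqP; rewrite -[RHS]dz3; ring.
  (* At c = 0 one has v0 = -1 and v4 = m, so the tangency equation reads d0 = m d2. *)
  rewrite dz; move: e => /(congr1 (horner^~ 0)); rewrite !hornerE !horner_coef0 /= -dq.
  move=> /= e; apply/eqP; rewrite -subr_eq0; apply/eqP; rewrite -[RHS]e e10 e20; ring.
(* The value m = 0 yields e1 = e2 = 0 and z1 = 2 u; then m = 1 yields 4 z2 = 0. *)
have [p3 p4 H0] := H 0; have [_ _ H1] := H 1.
have e20 : e2 = 0 by rewrite -p4 coef_Poly.
have e10 : e1 = 0.
  by move: p3; rewrite coef_Poly /= mulr0 addr0 => /eqP; rewrite oppr_eq0 => /eqP.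
have [e03 h0] := H0 e10 e20; have [_ h1] := H1 e10 e20.
have z1u : z1 = 2 * u.
  apply/eqP; rewrite -subr_eq0 -oppr_eq0 -subr_eq0; apply/eqP.
  move: h0; rewrite e03 => h0; rewrite -[RHS](subrr (0 * - (3 * z2 - 2 * z2))) {1}h0.
  by ring.
have z20 : z2 = 0.
  apply/eqP; have := natf_neq0_char0 char0 3.
  have : 4 * z2 = 0.
    by rewrite -[RHS](subrr (1 * - (e0 - 2 * z2))) {1}h1 e03 z1u; ring.
  by move=> /eqP; rewrite mulf_eq0 => /orP[->|].
exists z0, u => x t t0; have [-> ->] := E x t t0.
by rewrite e03 e10 e20 z20 z1u; split; ring.
Qed.

End FieldShape.

Lemma map_dual_coord (k : fieldType) (A : comAlgType k) n (u w : 'rV[A]_n) j :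
  (map_mx dual_const u + eps *: map_mx dual_const w) 0 j = (u 0 j, w 0 j) :> dual A.
Proof. by rewrite [RHS]dual_eta !mxE. Qed.

(** Two generators of one line differ by a scalar, read off at the coordinate [i] where the second
    is 1; the identity is the eps-part. *)
Lemma dual_spans_scale (k : fieldType) (A : comAlgType k)
    (s : surfaceS k (dual A)) (u w u' w' : 'rV[A]_5) i :
  spans s (map_mx dual_const u + eps *: map_mx dual_const w) ->
  spans s (map_mx dual_const u' + eps *: map_mx dual_const w') ->
  u' 0 i = 1 -> w' 0 i = 0 ->
  forall j, w 0 j = u 0 i * w' 0 j + w 0 i * u' 0 j.
Proof.
move=> su su' ui wi; have := spans_scale su su' (i := i).
rewrite !map_dual_coord ui wi => /(_ erefl)/rowP H j.
by have := H j; rewrite [RHS]mxE !map_dual_coord dualE => -[].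
Qed.

Lemma spansZ (k : fieldType) (s : surfaceS k k^o) (a : k^o) v :
  a != 0 -> spans s v -> spans s (a *: v).
Proof.
rewrite /spans => a0 ->; apply/seteqP; split=> _ [b _ <-].
  by exists (b / a); rewrite // scalerA divfK.
by exists (b * a); rewrite // scalerA.
Qed.

Lemma spans_chart1 (k : fieldType) (s : surfaceS k k^o) v :
  spans s v -> v 0 (inord 1) != 0 -> v 0 (inord 2) != 0 ->
  s = chart1_point (v 0 (inord 0) / v 0 (inord 2)) (v 0 (inord 2) / v 0 (inord 1)).
Proof.
move=> sv v1 v2; apply: spans_eq (spansZ (invr_neq0 v1) sv) _.
have := spans_quadrics sv; rewrite [in quadrics_vanish v](vec5_eta v).
rewrite [in _ *: v](vec5_eta v) scale_vec5 vec5E quadrics_vec5.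
move: (v 0 (inord 0)) (v 0 (inord 1)) (v 0 (inord 2)) (v 0 (inord 3)) (v 0 (inord 4)) v1 v2 =>
  x0 x1 x2 x3 x4 v1 v2 [e1 e2].
have x3E : x3 = x2 ^+ 2 / x1 by rewrite -e2 mulrC mulKf.
have x4E : x4 = - (x0 * (x0 + x3)) / x2.
  apply: (mulIf v2); rewrite divfK //; apply/eqP; rewrite -subr_eq0; apply/eqP.
  by rewrite -[RHS]e1; ring.
have := chart1_point_spans (x0 / x2) (x2 / x1); congr spans; rewrite x4E x3E.
by congr vec5; field; rewrite ?v1 ?v2.
Qed.

(** * The coefficient functions of a flow *)

Section FlowField.
Variables (k : fieldType) (F : flow k).
Hypothesis FF : is_flow F.

(** [Z] and [Q] are read off at the k-points of [chart1]. A curve, being a point over k[X], has a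
    polynomial tangent vector; specialising X to [c] must return these values, up to the change of
    normalisation that produces the terms in [d 1]. *)
Lemma flow_curve : exists Z Q : k -> k -> k,
  forall (s : surfaceS k {poly k}) v i, spans s v -> v 0 i = 1 ->
  exists d : 'rV[{poly k}]_5,
  [/\ d 0 i = 0,
      let v j := v 0 (inord j) in let d j := d 0 (inord j) in
      d 2%N * v 4%N + v 2%N * d 4%N + (v 0%N * d 0%N) *+ 2 + v 0%N * d 3%N + d 0%N * v 3%N = 0 /\
      v 1%N * d 3%N + d 1%N * v 3%N = (v 2%N * d 2%N) *+ 2,
      let v j c := (v 0 (inord j)).[c] in let d j c := (d 0 (inord j)).[c] in
      forall c, v 1%N c != 0 -> v 2%N c != 0 ->
      let x := v 0%N c / v 2%N c in let t := v 2%N c / v 1%N c in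
      d 0%N c = v 1%N c * Z x t + d 1%N c * (x * t) /\ d 2%N c = v 1%N c * Q x t + d 1%N c * t
    & forall (B : comAlgType k) (f : {lrmorphism {poly k} -> B}) (e : B)
        (ee : e * e = 0),
      spans (F ee (pmap f s)) (map_mx f v + e *: map_mx f d)].
Proof.
have /choice[D HD] : forall xt : k^o * k^o, exists d : 'rV[k^o]_5,
    d 0 (inord 1) = 0 /\
    spans (F (@eps_sq k k^o) (pmap dual_const (chart1_point xt.1 xt.2)))
      (map_mx dual_const (chart1 xt.1 xt.2) + eps *: map_mx dual_const d).
  move=> [x t]; have [d [d1 _ Fd]] := flow_tangent FF (chart1_point_spans x t) (chart1_coord x t).
  by exists d; split=> //; exact: Fd.
exists (fun x t => D (x, t) 0 (inord 0)), (fun x t => D (x, t) 0 (inord 2)).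
move=> s v i sv vi1; have [d [di ed Fd]] := flow_tangent FF sv vi1.
exists d; split=> //; cbv zeta => c v1c v2c.
pose ev := poly_eval (c : k^o).
have sc := spans_map ev sv.
have evE j : (map_mx ev v) 0 j = (v 0 j).[c] by rewrite mxE poly_eval_horner.
have := spans_chart1 sc; rewrite !evE => /(_ v1c v2c) {}sc.
have := Fd _ (dual_const \o ev : {lrmorphism _ -> _}) _ (@eps_sq k k^o).
rewrite pmap_comp sc => Ss.
have comp (u : 'rV[{poly k}]_5) :
    map_mx (dual_const \o ev) u = map_mx dual_const (map_mx ev u).
  by apply/rowP => j; rewrite !mxE.
rewrite !comp in Ss.
have [D1 SD] := HD ((v 0 (inord 0)).[c] / (v 0 (inord 2)).[c],
   (v 0 (inord 2)).[c] / (v 0 (inord 1)).[c]).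
have dE j : (map_mx ev d) 0 j = (d 0 j).[c] by rewrite mxE poly_eval_horner.
have H j := etrans (esym (dE j))
  (dual_spans_scale Ss SD (chart1_coord _ _) D1 j).
split; [rewrite H | rewrite H].
  congr (_ * _ + _ * _); [exact: evE | exact: dE |].
  by rewrite [chart1 _ _ 0 (inord 0)]vec5E.
congr (_ * _ + _ * _); [exact: evE | exact: dE |].
by rewrite [chart1 _ _ 0 (inord 2)]vec5E.
Qed.

End FlowField.

Lemma chart3_quadrics (R : comNzRingType) (v0 v2 v4 : R) :
  v0 ^+ 2 + v0 + v2 * v4 = 0 -> quadrics_vanish (vec5 v0 (v2 ^+ 2) v2 1 v4).
Proof. by move=> e; apply/quadrics_vec5; rewrite !mulr1. Qed.

Lemma chart3_coord (R : comNzRingType) (v0 v2 v4 : R) :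
  vec5 v0 (v2 ^+ 2) v2 1 v4 0 (inord 3) = 1.
Proof. by rewrite vec5E. Qed.

Lemma chart1_general_quadrics (R : comNzRingType) (v0 v2 v4 : R) :
  v0 ^+ 2 + v0 * v2 ^+ 2 + v2 * v4 = 0 ->
  quadrics_vanish (vec5 v0 1 v2 (v2 ^+ 2) v4).
Proof. by move=> e; apply/quadrics_vec5; rewrite !mul1r. Qed.

Lemma chart1_general_coord (R : comNzRingType) (v0 v2 v4 : R) :
  vec5 v0 1 v2 (v2 ^+ 2) v4 0 (inord 1) = 1.
Proof. by rewrite vec5E. Qed.

(* The vector field is (a + b x) d/dx + b t d/dt. *)
Definition flow_coeffs (k : fieldType) (F : flow k) (a b : k) : Prop :=
  forall (B : comAlgType k) (f : {lrmorphism {poly k} -> B}) (x t : {poly k})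
    (e : B) (ee : e * e = 0), t != 0 ->
  F B e ee (chart1_point (f x) (f t)) =
  chart1_point (f x + e * (a%:A + b%:A * f x)) (f t + e * (b%:A * f t)).

(** Curves in the two charts supply the hypotheses of [regular_field], which gives the field at
    k-points. Along a polynomial curve the formulas hold wherever t(c) is nonzero, hence as
    polynomial identities, and naturality yields all algebras. *)
Lemma flow_coeffs_ex (k : fieldType) (char0 : [pchar k] =i pred0) (F : flow k) :
  is_flow F -> exists a b, flow_coeffs F a b.
Proof.
move=> FF; have [Z [Q H]] := flow_curve FF.
have [||a [b E]] := @regular_field k char0 Z Q.
- move=> v0 v2 v4 e.
  have [d [d1 ed dE _]] := H _ _ _
    (point_spans (chart1_general_quadrics e) (chart1_general_coord _ _ _))
    (chart1_general_coord _ _ _).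
  move: ed dE; cbv beta zeta; rewrite !vec5E d1 mul1r mul0r addr0 => -[e1 e2] dE.
  exists (d 0 (inord 0)), (d 0 (inord 2)), (d 0 (inord 4)); split.
    by rewrite -[RHS]e1 e2; ring.
  move=> c c0; have := dE c; rewrite hornerC oner_eq0 c0 => /(_ isT isT).
  by rewrite !divr1 !horner0 !mul0r !addr0 !mul1r => -[-> ->].
- move=> v0 v2 v4 e.
  have [d [d3 ed dE _]] := H _ _ _
    (point_spans (chart3_quadrics e) (chart3_coord _ _ _)) (chart3_coord _ _ _).
  move: ed dE; cbv beta zeta; rewrite !vec5E d3 !mulr0 !mulr1 addr0 add0r => -[e1 e2] dE.
  exists (d 0 (inord 0)), (d 0 (inord 2)), (d 0 (inord 4)); split.
    by rewrite -[RHS]e1; ring.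
  move=> c c0; have := dE c; rewrite horner_exp expf_neq0 // c0 => /(_ isT isT).
  rewrite e2 hornerMn hornerM.
  have -> : v2.[c] / v2.[c] ^+ 2 = v2.[c]^-1 by field.
  move: (Z _ _) (Q _ _) => z q [e3 e4].
  (* Renormalising from x1 = 1 to x3 = 1 turns [e4] into d2 = v2^2 q + 2 d2. *)
  have d2E : - (v2.[c] ^+ 2 * q) = (d 0 (inord 2)).[c].
    apply/eqP; rewrite -subr_eq0; apply/eqP; move: e4.
    have -> : v2.[c] * (d 0 (inord 2)).[c] *+ 2 / v2.[c] = (d 0 (inord 2)).[c] *+ 2.
      by field.
    by move=> e4; rewrite -[RHS](subrr (d 0 (inord 2)).[c]) [X in _ = _ - X]e4; ring.
  by split=> //; rewrite e3 -d2E; field.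
exists a, b => B f x t e ee t0.
have [d [d1 [e1 e2] dE Fd]] := H _ _ _ (chart1_point_spans x t) (chart1_coord x t).
move: e1 e2 dE; cbv beta zeta; rewrite !vec5E d1 mul0r addr0 mul1r => e1 e2 dE.
have {}dE c : t.[c] != 0 ->
   (d 0 (inord 0)).[c] = ((a%:P + 2%:P * b%:P * x) * t).[c] /\
   (d 0 (inord 2)).[c] = (b%:P * t).[c].
  move=> c0; have := dE c; rewrite hornerC oner_eq0 c0 => /(_ isT isT).
  have [|-> ->] := E ((x * t).[c] / t.[c]) (t.[c] / 1); first by rewrite divr1.
  by move=> [-> ->]; rewrite horner0 !(hornerM, hornerD) !hornerC !divr1; split; field.
have d0E : d 0 (inord 0) = (a%:P + 2%:P * b%:P * x) * t.
  apply/eqP; rewrite -subr_eq0; apply/eqP; apply: (poly_eq0_generic char0 t0) => y.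
  by move=> /dE[+ _]; rewrite hornerD hornerN => ->; rewrite subrr.
have d2E : d 0 (inord 2) = b%:P * t.
  apply/eqP; rewrite -subr_eq0; apply/eqP; apply: (poly_eq0_generic char0 t0) => y.
  by move=> /dE[_]; rewrite hornerD hornerN => ->; rewrite subrr.
have d4E : d 0 (inord 4) =
   - ((a%:P + 2%:P * b%:P * x) * t * (x + t) +
      x * t * (a%:P + b%:P * x + b%:P * t)).
  apply: (mulfI t0); apply/eqP; rewrite -subr_eq0; apply/eqP.
  by rewrite -[RHS]e1 e2 d0E d2E; ring.
have := Fd B f e ee; rewrite chart1_point_map => sF; apply: spans_eq sF _.
rewrite chart1_map (vec5_eta d) d1 e2 mulr2n d0E d2E d4E map_vec5 scale_vec5.
have := chart1_point_spans (f x + e * (a%:A + b%:A * f x)) (f t + e * (b%:A * f t)).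
congr spans; rewrite /chart1; apply: rV5P.
have fC c : f c%:P = c%:A by rewrite -alg_polyC linearZ /= rmorph1.
(* The coordinates agree modulo [e * e]; [w] is the multiplier of [e * e] in each case. *)
have E0 w y z : y = z + e * e * w -> y = z by rewrite ee mul0r addr0.
do 5?case=> [|] //; rewrite [X in _ -> _ = X]mxE !vec5E => _;
  rewrite ?rmorphN ?(rmorphM, rmorphD) ?rmorph0 /= ?fC ?scale1r.
- by apply: (E0 (b%:A * f t * (a%:A + b%:A * f x))); ring.
- by rewrite mulr0 addr0.
- by ring.
- by apply: (E0 (b%:A ^+ 2 * f t ^+ 2)); ring.
- pose al := a%:A + b%:A * f x; pose be := b%:A * f t.
  apply: (E0 (- (al * be * (f x + f t) + (al * f t + f x * be) * (al + be) +
                 e * al * be * (al + be)))).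
  by rewrite /al /be; ring.
Qed.

(** * Vector fields vanishing on the open set *)

Lemma is_line_field_gen (k : fieldType) n (L : set 'rV[k]_n) :
  is_line L -> exists v, L v /\ v != 0.
Proof.
move=> [_ [m [f [w [[p [c [x [fx cx]]]] fw]]]]].
have [[i fi0]|f0] := pselect (exists i, f i != 0).
  have [Lw _ wfree] := fw i; exists (w i); split=> //.
  apply/eqP => w0; have [|N /eqP] := wfree 1; first by rewrite w0 scaler0.
  by rewrite mulr1 expf_eq0 (negbTE fi0) andbF.
have x0 j : x j = 0.
  have [i _ <-] := fx j; apply/eqP; apply: contraT => fi0.
  by case: f0; exists i.
move: cx; rewrite big1 => [/esym/eqP|j _]; first by rewrite oner_eq0.
by rewrite x0 mulr0.
Qed.

(** This expresses by a curve over k[X] that [s] lies in the closure of {x2 <> 0}: the curve meets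
    that set and passes through [s] at X = 0. *)
Definition generic_curve (k : fieldType) (s : surfaceS k k^o) : Prop :=
  exists (u : 'rV[{poly k}]_5) (i : 'I_5),
  [/\ quadrics_vanish u, u 0 i = 1, u 0 (inord 2) != 0
    & spans s (map_mx (poly_eval (0 : k^o)) u)].

Lemma poly_eval0_vec5 (k : fieldType) (u0 u1 u2 u3 u4 : {poly k}) :
  map_mx (poly_eval (0 : k^o)) (vec5 u0 u1 u2 u3 u4) =
  vec5 (u0.[0] : k^o) u1.[0] u2.[0] u3.[0] u4.[0].
Proof. by rewrite map_vec5; congr vec5; exact: poly_eval_horner. Qed.

(** The cases are x2 <> 0, with a constant curve; the line x0 = x2 = x3 = 0 away from x1 = 0; the
    A3-point (0:0:0:0:1); and the two lines x1 = x2 = 0 with x0 = 0 or x0 = -x3. *)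
Lemma generic_curve_ex (k : fieldType) (s : surfaceS k k^o) : generic_curve s.
Proof.
have [v [Lv v0]] := is_line_field_gen (svalP (sval s)).
have [j vj] : exists j, v 0 j != 0.
  apply/existsP; apply: contraT; rewrite negb_exists => /forallP v00.
  by case/eqP: v0; apply/rowP => j; rewrite mxE; apply/eqP; rewrite -[_ == _]negbK.
have sv : spans s v.
  have w1 : ((v 0 j)^-1 *: v) 0 j = 1 by rewrite mxE mulVf.
  have Lw : sval (sval s) ((v 0 j)^-1 *: v).
    have [[[L0 LD] _] _] := svalP (sval s).
    by rewrite -[_ *: v]addr0; apply: LD.
  have := spansZ vj (spans_mem Lw w1).
  by rewrite scalerA divff // scale1r.
have Xn (p : {poly k}) i : p`_i != 0 -> p != 0.
  by apply: contraNneq => ->; rewrite coef0.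
have qv := spans_quadrics sv.
move: sv vj qv; rewrite (vec5_eta v).
move: (v 0 (inord 0)) (v 0 (inord 1)) (v 0 (inord 2)) (v 0 (inord 3)) (v 0 (inord 4)).
move=> x0 x1 x2 x3 x4 {v v0 Lv} sv vj qv.
have [x20|x20] := eqVneq x2 0; last first.
  set v := vec5 _ _ _ _ _ in sv vj qv.
  exists (map_mx polyC ((v 0 j)^-1 *: v)), j; split.
  - move: (quadrics_scale (v 0 j)^-1 qv); rewrite (vec5_eta (_ *: v)).
    rewrite map_vec5 !quadrics_vec5 -!rmorphXn -!rmorphM -!rmorphD => -[-> ->].
    by rewrite rmorph0.
  - by rewrite mxE [X in polyC X]mxE mulVf.
  - by rewrite mxE polyC_eq0 mxE vec5E mulf_neq0 ?invr_eq0.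
  - have := spansZ (invr_neq0 vj) sv; congr spans.
    by apply/rowP => i; rewrite [RHS]mxE [map_mx polyC _ 0 i]mxE poly_evalC /GRing.scale /= mulr1.
move/quadrics_vec5: qv => [e1 e2]; rewrite x20 in e1 e2 sv vj.
rewrite mul0r addr0 in e1; rewrite expr0n /= in e2.
have [x10|x10] := eqVneq x1 0; last first.
  have x30 : x3 = 0.
    by move/eqP: e2; rewrite mulf_eq0 (negbTE x10) => /eqP.
  have x00 : x0 = 0.
    by move/eqP: e1; rewrite x30 mulr0 addr0 expf_eq0 => /eqP.
  (* Subtracting X keeps [p] nonzero even if x4 = 0. *)
  pose p : {poly k} := (x4 / x1)%:P - 'X.
  have p0 : p != 0 by apply: (Xn _ 1%N); rewrite coefB coefC coefX /= sub0r oppr_eq0 oner_eq0.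
  pose u0 := 'X * p; pose u2 := - ('X^2 * p).
  exists (vec5 u0 1 u2 (u2 ^+ 2) (p - u0 * u2)), (inord 1); split.
  - by apply/quadrics_vec5; rewrite /u2 /u0; split; ring.
  - by rewrite vec5E.
  - by rewrite vec5E oppr_eq0 mulf_neq0 // expf_neq0 // polyX_eq0.
  - have := spansZ (invr_neq0 x10) sv; congr spans; rewrite poly_eval0_vec5 scale_vec5.
    rewrite x00 x30 /u0 /u2 /p !hornerE /= !(mul0r, mulr0, subr0, oppr0) mulVf // expr0n /=.
    by rewrite mul0r oppr0 expr0n /= [_ * x4]mulrC.
have [x30|x30] := eqVneq x3 0.
  have x00 : x0 = 0.
    by move/eqP: e1; rewrite x30 mulr0 addr0 expf_eq0 => /eqP.
  have x40 : x4 != 0.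
    apply: contraNneq vj => x40; rewrite x00 x10 x30 x40; move: j => j.
    by rewrite -(inord_val j); case: j => -[|[|[|[|[|]]]]] //= _; rewrite vec5E.
  exists (vec5 'X ('X^2 * (1 + 'X) ^+ 2) (- ('X^2 * (1 + 'X))) 'X^2 1), (inord 4).
  split.
  - by apply/quadrics_vec5; split; ring.
  - by rewrite vec5E.
  - rewrite vec5E oppr_eq0 mulf_neq0 // ?expf_neq0 ?polyX_eq0 //.
    by apply: (Xn _ 1%N); rewrite coefD coefC coefX /= add0r oner_eq0.
  - have := spansZ (invr_neq0 x40) sv; congr spans; rewrite poly_eval0_vec5 scale_vec5.
    by rewrite x00 x10 x30 !hornerE /= ?expr0n /= ?(mul0r, mulr0, subr0, oppr0) mulVf.
pose z := x0 / x3; pose p : {poly k} := (x4 / x3)%:P - 'X.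
have zz : z = 0 \/ z = -1.
  have : x0 * (x0 + x3) = 0 by rewrite mulrDr -expr2.
  move/eqP; rewrite mulf_eq0 => /orP[/eqP x00|]; first by left; rewrite /z x00 mul0r.
  by rewrite addr_eq0 => /eqP x0E; right; rewrite /z x0E mulNr divff.
pose u0 : {poly k} := z%:P + 'X * p.
(* In u0 (u0 + 1) the factor vanishing at 0 is X p, and [w] is the other one. *)
have main (w : {poly k}) : w.[0] != 0 -> u0 ^+ 2 + u0 - 'X * w * p = 0 -> generic_curve s.
  move=> w0 ew; exists (vec5 u0 ((- ('X * w)) ^+ 2) (- ('X * w)) 1 p), (inord 3); split.
  - by apply/quadrics_vec5; rewrite !mulr1; split=> //; rewrite -[RHS]ew; ring.
  - by rewrite vec5E.
  - rewrite vec5E oppr_eq0 mulf_neq0 ?polyX_eq0 //.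
    by apply: contraNneq w0 => ->; rewrite horner0.
  - have := spansZ (invr_neq0 x30) sv; congr spans; rewrite poly_eval0_vec5 scale_vec5.
    rewrite x10 /u0 /p !hornerE /= !(mul0r, mulr0, subr0, oppr0, addr0) mulVf //.
    by rewrite expr0n /= mulrC [_ * x4]mulrC.
case: zz => zE.
  apply: (main (u0 + 1)); rewrite /u0 zE; last by ring.
  by rewrite !hornerE /= ?(mul0r, add0r, oner_eq0).
apply: (main u0); rewrite /u0 zE; last by ring.
by rewrite !hornerE /= ?(mul0r, addr0) oppr_eq0 oner_eq0.
Qed.

(** On a curve through [s] that meets {x2 <> 0}, the tangent vector vanishes wherever x2 is nonzero,
    hence identically, and in particular at X = 0. *)
Lemma flow_trivial (k : fieldType) (char0 : [pchar k] =i pred0) (F : flow k) :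
  is_flow F -> flow_coeffs F 0 0 ->
  forall (s : surfaceS k k^o) (B : comAlgType k) (f : {lrmorphism k^o -> B})
    (e : B) (ee : e * e = 0), F B e ee (pmap f s) = pmap f s.
Proof.
move=> FF F0 s B f e ee.
have [u [i [qu ui u2 su]]] := generic_curve_ex s.
have [d [di _ Fd]] := flow_tangent FF (point_spans qu ui) ui.
have F1 (x t : k^o) (C : comAlgType k) (h : {lrmorphism k^o -> C}) (e' : C)
    (ee' : e' * e' = 0) : t != 0 -> F C e' ee' (pmap h (chart1_point x t)) = pmap h (chart1_point x t).
  move=> t0; have E y : h y = poly_eval (0 : C) y%:P.
    by rewrite poly_evalC -(rmorph1 h) -linearZ /= /GRing.scale /= mulr1.
  rewrite chart1_point_map !E F0 ?polyC_eq0 //.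
  by rewrite !scale0r !mul0r !addr0 !mulr0 !addr0.
have d0 : d = 0.
  apply/rowP => j; rewrite mxE; apply: (poly_eq0_generic char0 u2) => c c2.
  pose ev := poly_eval (c : k^o).
  have evE (w : 'rV[{poly k}]_5) l : (map_mx ev w) 0 l = (w 0 l).[c].
    by rewrite mxE poly_eval_horner.
  have sc := spans_map ev (point_spans qu ui).
  have c1 : (u 0 (inord 1)).[c] != 0.
    have := qu; rewrite {1}(vec5_eta u) quadrics_vec5 => -[_ e2].
    apply: contraNneq c2 => c1; have : (u 0 (inord 2)).[c] ^+ 2 = 0.
      by rewrite -horner_exp -e2 hornerM c1 mul0r.
    by move=> /eqP; rewrite expf_eq0.
  have := spans_chart1 sc; rewrite !evE => /(_ c1 c2) {}scE.
  have comp (w : 'rV[{poly k}]_5) :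
      map_mx (dual_const \o ev) w = map_mx dual_const (map_mx ev w).
    by apply/rowP => l; rewrite !mxE.
  have := Fd _ (dual_const \o ev : {lrmorphism _ -> _}) _ (@eps_sq k k^o).
  rewrite pmap_comp {1}scE F1 -?scE; last by rewrite mulf_neq0 ?invr_eq0.
  rewrite !comp => S1.
  have S2 : spans (pmap dual_const (pmap ev (point qu ui)))
      (map_mx dual_const (map_mx ev u) + eps *: map_mx dual_const 0).
    by rewrite map_mx0 scaler0 addr0; exact: spans_map.
  have := dual_spans_scale S1 S2 (i := i); rewrite !evE ui hornerC mxE => /(_ erefl erefl j).
  by rewrite evE evE di horner0 mul0r mxE mulr0 addr0.
have -> : s = pmap (poly_eval (0 : k^o)) (point qu ui).
  by apply: spans_eq su _; apply: spans_map.
rewrite -pmap_comp; have := Fd _ (f \o poly_eval (0 : k^o) : {lrmorphism _ -> _}) _ ee.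
rewrite d0 map_mx0 scaler0 addr0 => S1; apply: spans_eq S1 _.
exact: spans_map (point_spans qu ui).
Qed.

(** * Commuting vector fields *)

Section Pencil.
Variables (k : fieldType) (F1 F2 : flow k) (c c' : k).
Hypotheses (FF1 : is_flow F1) (FF2 : is_flow F2).

Fact scaled_sq (B : comAlgType k) (a : k) (e : B) :
  e * e = 0 -> (a%:A * e) * (a%:A * e) = 0.
Proof. by move=> ee; rewrite mulrACA ee mulr0. Qed.

(** To first order this is the flow of c D1 + c' D2, where D1 and D2 are the fields of [F1] and
    [F2]. *)
Definition pencil : flow k :=
  fun B e ee s => F1 (scaled_sq c ee) (F2 (scaled_sq c' ee) s).

Lemma pencil_is_flow : is_flow pencil.
Proof.
have [F10 F1n] := FF1; have [F20 F2n] := FF2; split=> [B e ee s e0|A B f e e' ee ee' s fe].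
  by rewrite /pencil F10 ?F20 // e0 mulr0.
have fA a : f (a%:A * e) = a%:A * e' by rewrite rmorphM /= linearZ /= rmorph1 fe.
by rewrite /pencil (F1n _ _ _ _ _ _ (scaled_sq c ee')) // (F2n _ _ _ _ _ _ (scaled_sq c' ee')).
Qed.

End Pencil.

(* The inner flow moves [chart1_point 0 1] along the polynomial curve
   [chart1_point (a' X) (1 + b' X)], so [flow_coeffs] applies to the outer one. *)
Lemma flow_coeffs_comp (k : fieldType) (F1 F2 : flow k) (a b a' b' : k)
    (B : comAlgType k) (e e' : B) (ee : e * e = 0) (ee' : e' * e' = 0) :
  flow_coeffs F1 a b -> flow_coeffs F2 a' b' ->
  F1 B e ee (F2 B e' ee' (chart1_point 0 1)) =
  chart1_point (e' * a'%:A + e * (a%:A + b%:A * (e' * a'%:A)))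
      ((1 + e' * b'%:A) * (1 + e * b%:A)).
Proof.
move=> H1 H2; pose f := poly_eval e'.
have [f0 f1] : f 0 = 0 /\ f 1 = 1 by rewrite rmorph0 rmorph1.
have := H2 _ f 0 1 e' ee' (oner_neq0 _); rewrite f0 f1 => ->.
have fX : f ('X * a'%:P) = e' * a'%:A by rewrite rmorphM /= poly_evalX poly_evalC.
have fT : f (1 + 'X * b'%:P) = 1 + e' * b'%:A.
  by rewrite rmorphD rmorphM rmorph1 /= poly_evalX poly_evalC.
rewrite mulr0 addr0 add0r mulr1 -fX -fT H1 ?fX ?fT; last first.
  apply/eqP => /polyP/(_ 0%N)/eqP.
  by rewrite coefD coefXM coef1 coef0 /= addr0 oner_eq0.
by congr chart1_point; ring.
Qed.

Lemma dual_alg (k : fieldType) (A : comAlgType k) (a : k) :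
  a%:A = (a%:A, 0) :> dual A.
Proof. by congr pair; rewrite scaler0. Qed.

(** The value of a field at x = 0, t = 1 already determines its two coefficients. *)
Lemma pencil_coeffs (k : fieldType) (F1 F2 : flow k) (c c' a b a' b' a'' b'' : k) :
  flow_coeffs F1 a b -> flow_coeffs F2 a' b' ->
  flow_coeffs (pencil F1 F2 c c') a'' b'' ->
  a'' = c * a + c' * a' /\ b'' = c * b + c' * b'.
Proof.
move=> H1 H2 H.
have A1 (x : k) : x%:A = x :> k^o by rewrite /GRing.scale /= mulr1.
have := H _ (poly_eval 0) 0 1 _ (@eps_sq k k^o) (oner_neq0 _).
rewrite rmorph0 rmorph1 /pencil (flow_coeffs_comp _ _ H1 H2).
move=> /chart1_point_inj[/(congr1 snd) + /(congr1 snd)]; rewrite !dual_alg !A1 !dualE /=.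
rewrite !(mul0r, mulr0, mul1r, mulr1, add0r, addr0) => <- <-.
by rewrite addrC.
Qed.

(** The two sides are the coordinates x t of the composites in either order; their coefficients at e
    e' are 2 a' b + a b' and 2 a b' + a' b. *)
Lemma commutator_coeff (B : comNzRingType) (e e' a b a' b' : B) :
  e * e = 0 -> e' * e' = 0 ->
  (e' * a' + e * (a + b * (e' * a'))) * ((1 + e' * b') * (1 + e * b)) =
  (e * a + e' * (a' + b' * (e * a))) * ((1 + e * b) * (1 + e' * b')) ->
  (b * a' - b' * a) * (e * e') = 0.
Proof.
have red (x y a1 b1 a2 b2 : B) : x * x = 0 -> y * y = 0 ->
    (y * a2 + x * (a1 + b1 * (y * a2))) * ((1 + y * b2) * (1 + x * b1)) =
    y * a2 + x * a1 + x * y * (2 * a2 * b1 + a1 * b2).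
  move=> xx yy; transitivity (y * a2 + x * a1 + x * y * (2 * a2 * b1 + a1 * b2) +
    x * x * (a1 * b1 + y * a1 * b1 * b2 + y * b1 ^+ 2 * a2 +
             y ^+ 2 * b1 ^+ 2 * b2 * a2) +
    y * y * (a2 * b2 + 2 * x * a2 * b1 * b2)); first by ring.
  by rewrite xx yy !mul0r !addr0.
move=> ee ee'; rewrite !red // => /eqP; rewrite -subr_eq0 => /eqP E.
by rewrite -[RHS]E; ring.
Qed.

(** Over iterated dual numbers the two times are independent and have nonzero product, so the
    bracket of the fields can be read off. *)
Lemma commuting_flow_coeffs (k : fieldType) (F1 F2 : flow k) (a b a' b' : k) :
  flow_coeffs F1 a b -> flow_coeffs F2 a' b' ->
  (forall (B : comAlgType k) (e e' : B) (ee : e * e = 0) (ee' : e' * e' = 0) s,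
     F1 B e ee (F2 B e' ee' s) = F2 B e' ee' (F1 B e ee s)) ->
  b * a' = b' * a.
Proof.
move=> H1 H2 comm.
have ee' : dual_const (eps : dual k^o) * dual_const (eps : dual k^o) = 0.
  by rewrite -rmorphM eps_sq rmorph0.
have := comm _ _ _ (@eps_sq k (dual k^o)) ee' (chart1_point 0 1).
rewrite (flow_coeffs_comp _ _ H1 H2) (flow_coeffs_comp _ _ H2 H1) => /chart1_point_inj[+ _].
move=> /(commutator_coeff (@eps_sq k (dual k^o)) ee').
have -> : b%:A * a'%:A - b'%:A * a%:A = (b * a' - b' * a)%:A :> dual (dual k^o).
  by rewrite -!scalerAl !mul1r !scalerA scalerBl.
move=> E; apply/eqP; rewrite -subr_eq0; apply/eqP; move: E; rewrite mulr_algl.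
(* This component is the coefficient of the product of the two times. *)
move=> /(congr1 (fun z : dual (dual k^o) => z.2.2)).
by rewrite /= !(mul0r, mul1r, add0r, addr0) /GRing.scale /= mulr1.
Qed.

(** * Actions of groups with commuting tangent directions *)

Lemma gmulV_r (k : fieldType) (G : kgroup k) (A : comAlgType k) (x : G A) :
  gmul x (ginv x) = gone G A.
Proof.
by apply: gmul_idem; rewrite -gmulA [gmul (ginv x) _]gmulA gmulV gmul1.
Qed.

Lemma gmul1_r (k : fieldType) (G : kgroup k) (A : comAlgType k) (x : G A) :
  gmul x (gone G A) = x.
Proof. by rewrite -(gmulV x) gmulA gmulV_r gmul1. Qed.

Lemma pmap_gone (k : fieldType) (G : kgroup k) (A B : comAlgType k)
    (f : {lrmorphism A -> B}) : pmap f (gone G A) = gone G B.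
Proof. by apply: gmul_idem; rewrite -pmap_mul gmul1. Qed.

(** A tangent vector at the identity, given at every square-zero time in parallel with [flow]. *)
Definition tangent_family (k : fieldType) (G : kgroup k) : Type :=
  forall (A : comAlgType k) (e : A), e * e = 0 -> G A.

Definition is_tangent_family (k : fieldType) (G : kgroup k)
    (g : tangent_family G) : Prop :=
  (forall (A : comAlgType k) (e : A) (ee : e * e = 0), e = 0 -> g A e ee = gone G A) /\
  (forall (A B : comAlgType k) (f : {lrmorphism A -> B}) (e : A) (e' : B)
     (ee : e * e = 0) (ee' : e' * e' = 0),
     f e = e' -> pmap f (g A e ee) = g B e' ee').

Definition act_flow (k : fieldType) (G : kgroup k)
    (act : forall A : comAlgType k, G A -> surfaceS k A -> surfaceS k A)
    (g : tangent_family G) : flow k :=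
  fun A e ee s => act A (g A e ee) s.

Lemma act_flow_is_flow (k : fieldType) (G : kgroup k)
    (act : forall A : comAlgType k, G A -> surfaceS k A -> surfaceS k A)
    (g : tangent_family G) :
  is_action act -> is_tangent_family g -> is_flow (act_flow act g).
Proof.
move=> [act1 _ act_map] [g0 gn]; split=> [A e ee s e0|A B f e e' ee ee' s fe].
  by rewrite /act_flow g0.
by rewrite /act_flow act_map (gn _ _ _ _ _ _ ee').
Qed.

Theorem not_commutative_compactification (k : fieldType)
    (char0 : [pchar k] =i pred0) (G : kgroup k) (g1 g2 : tangent_family G) :
  is_tangent_family g1 -> is_tangent_family g2 ->
  (forall (A : comAlgType k) (e e' : A) (ee : e * e = 0) (ee' : e' * e' = 0),
     gmul (g1 A e ee) (g2 A e' ee') = gmul (g2 A e' ee') (g1 A e ee)) ->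
  (forall c c' : k,
     gmul (g1 _ _ (scaled_sq c (@eps_sq k k^o))) (g2 _ _ (scaled_sq c' (@eps_sq k k^o))) =
     gone G _ -> c = 0 /\ c' = 0) ->
  ~ equivariant_compactification G (surfaceS k).
Proof.
move=> T1 T2 comm indep [act [U [j [actP _ jn /(_ _)/proj1 jinj jM]]]].
have FF1 := act_flow_is_flow actP T1; have FF2 := act_flow_is_flow actP T2.
have [a [b H1]] := flow_coeffs_ex char0 FF1.
have [a' [b' H2]] := flow_coeffs_ex char0 FF2.
have dep : b * a' = b' * a.
  apply: commuting_flow_coeffs H1 H2 _ => B e e' ee ee' s.
  by have [_ actM _] := actP; rewrite /act_flow -!actM comm.
(* By [dep] the pairs (a, b) and (a', b') are proportional: (a', -a) works unless a = a' = 0, then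
   (b', -b) unless both pairs are zero, and then (1, 0). *)
have [c [c' [nz ca cb]]] : exists c c' : k,
    [/\ ~ (c = 0 /\ c' = 0), c * a + c' * a' = 0 & c * b + c' * b' = 0].
  have [[a0 a'0]|n] := pselect (a' = 0 /\ a = 0); last first.
    exists a', (- a); split.
    - by move=> [a'0 /eqP]; rewrite oppr_eq0 => /eqP a0; apply: n.
    - by ring.
    - by rewrite [a' * b]mulrC dep; ring.
  have [[b0 b'0]|n] := pselect (b' = 0 /\ b = 0).
    exists 1, 0; rewrite a'0 b'0 !mulr0 !mul0r !addr0; split=> // -[/eqP].
    by rewrite oner_eq0.
  exists b', (- b); split.
  - by move=> [b'0 /eqP]; rewrite oppr_eq0 => /eqP b0; apply: n.
  - by rewrite a0 a'0; ring.
  - by ring.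
have FF := pencil_is_flow c c' FF1 FF2.
have [a'' [b'' H]] := flow_coeffs_ex char0 FF.
have [a0 b0] := pencil_coeffs H1 H2 H; rewrite ca cb in a0 b0; subst a'' b''.
apply: nz; apply: indep; set g := gmul _ _.
(* The trivial flow fixes the image of 1, which [g] moves to [j g]; injectivity of [j] gives g =
   1. *)
have := flow_trivial char0 FF H (j _ (gone G k^o)) dual_const (@eps_sq k k^o).
have [_ actM _] := actP; rewrite /pencil /act_flow -actM -/g jn pmap_gone -jM.
by move=> /jinj; rewrite gmul1_r.
Qed.

(** * The vector group and the torus *)

Lemma not_vector_compactification (k : fieldType) (char0 : [pchar k] =i pred0) :
  ~ equivariant_compactification (direct_product (Ga k) (Ga k)) (surfaceS k).
Proof.
apply: (@not_commutative_compactification k char0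
  (direct_product (Ga k) (Ga k)) (fun A e _ => (e, 0)) (fun A e _ => (0, e))).
- by split=> [A e _ ->|A B f e e' _ _ fe] //=; rewrite fe rmorph0.
- by split=> [A e _ ->|A B f e e' _ _ fe] //=; rewrite fe rmorph0.
- by move=> A e e' _ _; rewrite /= !addr0 !add0r.
- move=> c c'; rewrite /= addr0 add0r => E.
  have := congr1 (snd \o snd) E; have := congr1 (snd \o fst) E.
  rewrite !dual_alg !dualE /= !mulr1 !mul0r !addr0.
  by rewrite /GRing.scale /= !mulr1.
Qed.

Fact one_plus_subproof (R : comNzRingType) (e : R) :
  e * e = 0 -> (1 + e, 1 - e).1 * (1 + e, 1 - e).2 == 1.
Proof. by move=> ee; rewrite /= mulrC -subr_sqr expr1n expr2 ee subr0. Qed.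

Definition one_plus (R : comNzRingType) (e : R) (ee : e * e = 0) : Gm_pts R :=
  exist _ (1 + e, 1 - e) (one_plus_subproof ee).

Lemma Gm_eq (R : comNzRingType) (s t : Gm_pts R) : sval s = sval t -> s = t.
Proof. by case: s t => [s ?] [t ?] /= e; apply: eq_exist. Qed.

Lemma not_toric (k : fieldType) (char0 : [pchar k] =i pred0) :
  ~ toric (surfaceS k).
Proof.
apply: (@not_commutative_compactification k char0
  (direct_product (Gm k) (Gm k)) (fun A e ee => (one_plus ee, gone (Gm k) A))
  (fun A e ee => (gone (Gm k) A, one_plus ee))).
- split=> [A e ee e0|A B f e e' ee ee' fe]; congr pair; apply: Gm_eq => /=.
  + by rewrite e0 addr0 subr0.
  + by rewrite -fe rmorphD rmorphB rmorph1.
  + by rewrite rmorph1.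
- split=> [A e ee e0|A B f e e' ee ee' fe]; congr pair; apply: Gm_eq => /=.
  + by rewrite e0 addr0 subr0.
  + by rewrite rmorph1.
  + by rewrite -fe rmorphD rmorphB rmorph1.
- by move=> A e e' ee ee'; congr pair; apply: Gm_eq; rewrite /= !mulr1 !mul1r.
- move=> c c' E.
  have := congr1 (fun p => (sval p.2).1.2) E.
  have := congr1 (fun p => (sval p.1).1.2) E => /=.
  rewrite !(scaler0, mulr1, mul1r, mulr0, mul0r, addr0, add0r).
  by rewrite /GRing.scale /= !mulr1.
Qed.

Theorem mainTheorem2 (k : fieldType) (char0 : [pchar k]%R =i pred0) :
  equivariant_compactification (Ga_rtimes_Gm k) (surfaceS k) /\
  ~ toric (surfaceS k) /\
  ~ equivariant_compactification (direct_product (Ga k) (Ga k)) (surfaceS k).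
Proof.
split; first exact: surfaceS_Ga_rtimes_Gm.
split; first exact: not_toric.
exact: not_vector_compactification.
Qed.
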